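(* Let $n\ge 1$, let $s_1<s_2$ be real, and let $\omega_1\ge 0$, $\omega_2\ge 0$ with $\omega_1\ne\omega_2$ and $\omega_1\neq 1$. Let $D_n(s_1,s_2)$ be the Hankel determinant of the Gaussian weight with two jumps, let $\pi_n$, $\gamma_n$, $\alpha_n$, $\beta_n$ be the associated monic orthogonal polynomials, leading coefficients and recurrence coefficients, and let $y(x;s)$, $a_k(x;s)$, $b_k(x;s)$ ($k=1,2$) be the functions defined in the context. Put $$F(s_1,s_2)=\frac{\partial}{\partial s_1}\ln D_n(s_1,s_2)+\frac{\partial}{\partial s_2}\ln D_n(s_1,s_2),\qquad x=\frac{s_1+s_2}{2},\quad s=\frac{s_2-s_1}{2}.$$ Then, for fixed $s$, the functions $a_k,b_k$ of $x$ satisfy the coupled Painlevé IV system $$\frac{da_1}{dx}=-2a_1(a_1+a_2+b_1-x+s),\qquad \frac{da_2}{dx}=-2a_2(a_1+a_2+b_2-x-s),$$ $$\frac{db_1}{dx}=b_1^2+2b_1(2a_1+a_2-x+s)+2(a_2b_2+n),\qquad \frac{db_2}{dx}=b_2^2+2b_2(a_1+2a_2-x-s)+2(a_1b_1+n),$$ and $\frac{dy}{dx}=2(a_1+a_2-x)y$. Moreover $$F(s_1,s_2)=H_{\mathrm{IV}}(x;s)-2nx,$$ where $H_{\mathrm{IV}}(x;s)$ is the Hamiltonian $$H_{\mathrm{IV}}=-2(a_1b_1+a_2b_2+n)(a_1+a_2)+2\big(a_1b_1(x-s)+a_2b_2(x+s)+nx\big)-(a_1b_1^2+a_2b_2^2)$$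 evaluated at $a_k=a_k(x;s)$, $b_k=b_k(x;s)$, and, with $a_k,b_k,y$ evaluated at $(x;s)$, $$\alpha_n(s_1,s_2)=\frac{a_1b_1^2+a_2b_2^2}{2(a_1b_1+a_2b_2+n)},\qquad \beta_n^2(s_1,s_2)=\tfrac12\,(a_1b_1+a_2b_2+n),$$ $$\gamma_{n-1}^2=\frac{1}{4\pi i}e^{x^2}y(x;s)\neq 0,\qquad \frac{d}{dx}\ln\gamma_{n-1}(s_1,s_2)=a_1+a_2,$$ $$\pi_n(s_1)^2=\frac{2\pi i}{\omega_1-1}e^{-2sx+s^2}\frac{a_1b_1^2}{y},\qquad \pi_n(s_2)^2=\frac{2\pi i}{\omega_2-\omega_1}e^{2sx+s^2}\frac{a_2b_2^2}{y},$$ where $d/dx$ is taken with $s$ fixed.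
   Context: Weight: $w(t)=w(t;s_1,s_2;\omega_1,\omega_2)=e^{-t^2}\theta(t)$ with $\theta(t)=1$ for $t<s_1$, $\theta(t)=\omega_1$ for $s_1<t<s_2$, $\theta(t)=\omega_2$ for $t>s_2$. Hankel determinant: $D_n(s_1,s_2)=D_n(s_1,s_2;\omega_1,\omega_2)=\det\left(\int_{\mathbb R}t^{j+k}w(t)\,dt\right)_{j,k=0}^{n-1}$. Orthogonal polynomials: $\pi_n(z)=\pi_n(z;s_1,s_2)=z^n+\cdots$ are monic with $\int_{\mathbb R}\pi_m\pi_n w\,dt=\gamma_n^{-2}\delta_{m,n}$, $\gamma_n=\gamma_n(s_1,s_2)>0$, and $z\pi_n(z)=\pi_{n+1}(z)+\alpha_n\pi_n(z)+\beta_n^2\pi_{n-1}(z)$. Define for $z\in\mathbb C\setminus\mathbb R$ $$Y(z)=\begin{pmatrix}\pi_n(z)&\frac1{2\pi i}\int_{\mathbb R}\frac{\pi_n(t)w(t)}{t-z}dt\\ -2\pi i\gamma_{n-1}^2\pi_{n-1}(z)&-\gamma_{n-1}^2\int_{\mathbb R}\frac{\pi_{n-1}(t)w(t)}{t-z}dt\end{pmatrix},$$ $$\Phi(z;x,s)=\sigma_1e^{\frac{x^2}{2}\sigma_3}Y(z+x)e^{-\frac12(z+x)^2\sigma_3}\sigma_1,$$ where $\sigma_1=\begin{pmatrix}0&1\\1&0\end{pmatrix}$, $\sigma_3=\mathrm{diag}(1,-1)$, and $x=(s_1+s_2)/2$, $s=(s_2-s_1)/2$. As $z\to\infty$, $\Phi(z)=\left(I+\frac{\Phi_1}{z}+\frac{\Phi_2}{z^2}+O(z^{-3})\right)e^{(\frac12z^2+xz)\sigma_3}z^{-n\sigma_3}$.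 The matrix $\Phi_z\Phi^{-1}$ is rational in $z$ with simple poles only at $z=\mp s$; let $A_1,A_2$ be its residues at $z=-s$ and $z=s$, respectively. Then $y,a_k,b_k$ are defined by $$y=-2(\Phi_1)_{12},\qquad (A_k)_{12}=a_k y,\qquad (A_k)_{11}=a_kb_k,\quad k=1,2.$$ Identities and differential equations involving $b_k$ are understood at points where $a_k\neq0$, so that $b_k$ is defined. *)

(* Defs.v *)
From mathcomp Require Import all_boot all_order all_algebra.
From mathcomp Require Import complex.
From mathcomp Require Import all_classical all_reals all_analysis.

Set Implicit Arguments.
Unset Strict Implicit.
Unset Printing Implicit Defensive.

Import Order.TTheory GRing.Theory Num.Theory.
Import numFieldNormedType.Exports.
Local Open Scope classical_set_scope.
Local Open Scope ring_scope.
Local Open Scope complex_scope.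

(* The values at the two jumps are immaterial: only integrals against the weight
   are ever taken. *)
Definition weight (R : realType) (s1 s2 w1 w2 t : R) : R :=
  expR (- t ^+ 2) * (if t < s1 then 1 else if t < s2 then w1 else w2).

Definition hankel (R : realType) (n : nat) (w1 w2 s1 s2 : R) : R :=
  \det (\matrix_(j < n, k < n)
    \int[@lebesgue_measure R]_t (t ^+ (j + k) * weight s1 s2 w1 w2 t)).

Definition F_hankel (R : realType) (n : nat) (w1 w2 s1 s2 : R) : R :=
  derive1 (fun u : R => ln (hankel n w1 w2 u s2)) s1 +
  derive1 (fun u : R => ln (hankel n w1 w2 s1 u)) s2.

(* The recurrence at n = 0 uses the convention that the polynomial of index -1
   is zero. *)
Definition orthogonal_system (R : realType) (w : R -> R)
    (p : nat -> {poly R}) (gamma alpha beta : nat -> R) : Prop :=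
  [/\ forall n, p n \is monic /\ size (p n) = n.+1,
      forall n, 0 < gamma n,
      forall m n, \int[@lebesgue_measure R]_t ((p m).[t] * (p n).[t] * w t) =
        (if m == n then (gamma n) ^- 2 else 0)
    & forall n, 'X * p n = p n.+1 + alpha n *: p n +
        (if n is m.+1 then beta n ^+ 2 *: p m else 0)].

Definition cexp (R : realType) (z : R[i]) : R[i] :=
  (expR (complex.Re z))%:C * (cos (complex.Im z) +i* sin (complex.Im z)).

Definition cintegral (R : realType) (f : R -> R[i]) : R[i] :=
  (\int[@lebesgue_measure R]_t complex.Re (f t)) +i*
  (\int[@lebesgue_measure R]_t complex.Im (f t)).

Definition is_derive_RC (R : realType) (f : R -> R[i]) (x : R) (l : R[i]) : Prop :=
  is_derive x (1 : R) (fun u => complex.Re (f u)) (complex.Re l) /\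
  is_derive x (1 : R) (fun u => complex.Im (f u)) (complex.Im l).

Definition mx2 (R : realType) (a b c d : R[i]) : 'M[R[i]]_2 :=
  \matrix_(i < 2, j < 2)
    (if i == 0 then if j == 0 then a else b else if j == 0 then c else d).

Definition sigma1 (R : realType) : 'M[R[i]]_2 := mx2 0 1 1 0.

(* exp_sigma3 c is e^(c sigma3), and pow_sigma3 n z is z^(n sigma3). *)
Definition exp_sigma3 (R : realType) (c : R[i]) : 'M[R[i]]_2 :=
  mx2 (cexp c) 0 0 (cexp (- c)).

Definition pow_sigma3 (R : realType) (n : nat) (z : R[i]) : 'M[R[i]]_2 :=
  mx2 (z ^+ n) 0 0 (z ^- n).

Definition ceval (R : realType) (q : {poly R}) (z : R[i]) : R[i] :=
  (map_poly (real_complex R) q).[z].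

(* Integral of q(t) w(t) / (t - z) over the line, without the factor 1/(2 pi i). *)
Definition cauchy_int (R : realType) (w : R -> R) (q : {poly R}) (z : R[i]) : R[i] :=
  cintegral (fun t => (q.[t] * w t)%:C / (t%:C - z)).

Definition two_pi_i (R : realType) : R[i] := 0 +i* (2 * pi).

(* Y and Phi are meant for non-real z and for n >= 1. *)
Definition Ymx (R : realType) (w : R -> R) (p : nat -> {poly R}) (gamma : nat -> R)
    (n : nat) (z : R[i]) : 'M[R[i]]_2 :=
  mx2 (ceval (p n) z)
      ((two_pi_i R)^-1 * cauchy_int w (p n) z)
      (- two_pi_i R * (gamma n.-1 ^+ 2)%:C * ceval (p n.-1) z)
      (- (gamma n.-1 ^+ 2)%:C * cauchy_int w (p n.-1) z).

Definition Phimx (R : realType) (w : R -> R) (p : nat -> {poly R}) (gamma : nat -> R)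
    (n : nat) (x : R) (z : R[i]) : 'M[R[i]]_2 :=
  sigma1 R *m exp_sigma3 (x ^+ 2 / 2)%:C *m Ymx w p gamma n (z + x%:C)
    *m exp_sigma3 (- ((z + x%:C) ^+ 2 / 2)) *m sigma1 R.

(* f(z) = c0 + c1/z + c2/z^2 + O(z^-3) as z tends to infinity off the real axis. *)
Definition expands_at_infty (R : realType) (f : R[i] -> R[i]) (c0 c1 c2 : R[i]) : Prop :=
  exists K M : R, forall z : R[i], complex.Im z != 0 -> M%:C < `|z| ->
    `|f z - (c0 + c1 / z + c2 / z ^+ 2)| <= K%:C / `|z| ^+ 3.

(* The coefficient Phi_1 of
     Phi(z) z^(n sigma3) e^(-(z^2/2 + xz) sigma3) = I + Phi_1/z + Phi_2/z^2 + O(z^-3),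
   taken entry by entry; it is unique when the expansion exists. *)
Definition Phi1mx (R : realType) (w : R -> R) (p : nat -> {poly R}) (gamma : nat -> R)
    (n : nat) (x : R) : 'M[R[i]]_2 :=
  \matrix_(i < 2, j < 2) xget 0 [set c1 : R[i] | exists c2 : R[i],
    expands_at_infty
      (fun z => (Phimx w p gamma n x z *m pow_sigma3 n z
                  *m exp_sigma3 (- (z ^+ 2 / 2 + x%:C * z))) i j)
      ((1%:M : 'M[R[i]]_2) i j) c1 c2].

Definition dPhimx (R : realType) (w : R -> R) (p : nat -> {poly R}) (gamma : nat -> R)
    (n : nat) (x : R) (z : R[i]) : 'M[R[i]]_2 :=
  \matrix_(i < 2, j < 2)
    derive1 (fun v : R[i] => Phimx w p gamma n x v i j : R[i]^o) z.

(* L coincides off the real axis with a rational matrix function whose only finite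
   poles are simple ones, at z = -s with residue A.1 and at z = s with residue A.2. *)
Definition simple_poles_residues (R : realType) (L : R[i] -> 'M[R[i]]_2) (s : R)
    (A : 'M[R[i]]_2 * 'M[R[i]]_2) : Prop :=
  exists P : 'M[{poly R[i]}]_2, forall z : R[i], complex.Im z != 0 ->
    L z = map_mx (fun q : {poly R[i]} => q.[z]) P
          + (z + s%:C)^-1 *: A.1 + (z - s%:C)^-1 *: A.2.

Definition residues (R : realType) (w : R -> R) (p : nat -> {poly R}) (gamma : nat -> R)
    (n : nat) (x s : R) : 'M[R[i]]_2 * 'M[R[i]]_2 :=
  xget (0, 0) [set A | simple_poles_residues
    (fun z => dPhimx w p gamma n x z *m invmx (Phimx w p gamma n x z)) s A].

(* From here on the polynomials p and the constants gamma depend on the jump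
   locations, which are s1 = x - s and s2 = x + s. *)
Definition y_fun (R : realType) (n : nat) (w1 w2 : R)
    (p : R -> R -> nat -> {poly R}) (gamma : R -> R -> nat -> R) (x s : R) : R[i] :=
  - 2 * Phi1mx (weight (x - s) (x + s) w1 w2) (p (x - s) (x + s))
          (gamma (x - s) (x + s)) n x 0 1.

Definition A_fun (R : realType) (n : nat) (w1 w2 : R)
    (p : R -> R -> nat -> {poly R}) (gamma : R -> R -> nat -> R) (x s : R) :
    'M[R[i]]_2 * 'M[R[i]]_2 :=
  residues (weight (x - s) (x + s) w1 w2) (p (x - s) (x + s))
    (gamma (x - s) (x + s)) n x s.

Definition a1_fun (R : realType) (n : nat) (w1 w2 : R)
    (p : R -> R -> nat -> {poly R}) (gamma : R -> R -> nat -> R) (x s : R) : R[i] :=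
  (A_fun n w1 w2 p gamma x s).1 0 1 / y_fun n w1 w2 p gamma x s.

Definition a2_fun (R : realType) (n : nat) (w1 w2 : R)
    (p : R -> R -> nat -> {poly R}) (gamma : R -> R -> nat -> R) (x s : R) : R[i] :=
  (A_fun n w1 w2 p gamma x s).2 0 1 / y_fun n w1 w2 p gamma x s.

(* Meaningful only where the corresponding a1_fun, a2_fun does not vanish. *)
Definition b1_fun (R : realType) (n : nat) (w1 w2 : R)
    (p : R -> R -> nat -> {poly R}) (gamma : R -> R -> nat -> R) (x s : R) : R[i] :=
  (A_fun n w1 w2 p gamma x s).1 0 0 / a1_fun n w1 w2 p gamma x s.

Definition b2_fun (R : realType) (n : nat) (w1 w2 : R)
    (p : R -> R -> nat -> {poly R}) (gamma : R -> R -> nat -> R) (x s : R) : R[i] :=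
  (A_fun n w1 w2 p gamma x s).2 0 0 / a2_fun n w1 w2 p gamma x s.

Definition H_IV (R : realType) (n : nat) (a1 a2 b1 b2 x s : R[i]) : R[i] :=
  - 2 * (a1 * b1 + a2 * b2 + n%:R) * (a1 + a2)
  + 2 * (a1 * b1 * (x - s) + a2 * b2 * (x + s) + n%:R * x)
  - (a1 * b1 ^+ 2 + a2 * b2 ^+ 2).

(* Main.v *)
(* The derivative of a Cauchy transform of the weight differs from a Cauchy transform
   only by the jump contributions at s_1 and s_2, so the entries of Phi_z Phi^(-1) are
   polynomials up to simple poles at the jumps. Their residues, together with the first
   coefficient of Phi at infinity, give
     a_k = D_k gamma_(n-1)^2 pi_(n-1)(s_k)^2 / 2,   b_k = 2 pi_n(s_k) / pi_(n-1)(s_k),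
     y = 4 pi i gamma_(n-1)^2 e^(-x^2),
   where D_1 = (w_1 - 1) e^(-s_1^2) and D_2 = (w_2 - w_1) e^(-s_2^2).
   Write L(q) for the integral of q against the weight. Then
     L(q' - 2tq) = - D_1 q(s_1) - D_2 q(s_2)
   is also the derivative of L(q) in x for fixed s. Differentiating the orthogonality
   relations yields, along this shift,
     (pi_j(s_k))' = 2 beta_j^2 pi_(j-1)(s_k),   (gamma_j^(-2))' = - 2 alpha_j gamma_j^(-2),
   which are the differential equations. Taking q = pi_n^2, pi_n pi_(n-1) and
   t pi_n pi_(n-1) expresses alpha_n, beta_n^2 and the subleading coefficient of pi_n
   through a_k and b_k, and F is twice that coefficient, because D_n is the product of
   the gamma_j^(-2) for j < n. *)

From HB Require Import structures.
Require Import Defs.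
From mathcomp Require Import all_boot all_order all_algebra.
From mathcomp Require Import complex ring lra.
From mathcomp Require Import all_classical all_reals all_analysis.
From mathcomp Require Import measurable_realfun gauss_integral.

Set Implicit Arguments.
Unset Strict Implicit.
Unset Printing Implicit Defensive.

Import Order.TTheory GRing.Theory Num.Theory.
Import numFieldNormedType.Exports.
Local Open Scope classical_set_scope.
Local Open Scope ring_scope.
Local Open Scope complex_scope.

(** An orthogonal system is given separately for every pair of jump locations, so its dependence on
    them carries no regularity at the outset. Differentiability has to be proved before an
    orthogonality relation can be differentiated; it is inherited from the moments through
    Gram-Schmidt, the monic orthogonal polynomials being unique. The weight itself is discontinuous.
    Splitting its step factor into a constant and two half-line indicators leaves integrals of
    smooth functions, and the fundamental theorem of calculus then yields both the motion of the
    jumps and integration by parts. Neither boundary values on the real axis nor asymptotics of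
    Cauchy transforms enter. Each entry of Phi_z Phi^(-1) is a determinant in which the Cauchy
    transforms cancel up to a polynomial and two simple fractions, and y only involves the entry
    (1,2) of Phi_1, where no Cauchy transform occurs. The functions a_k and b_k come out real and y
    is i times a real function, so the differential equations reduce to real calculus in the values
    of pi_(n-1) and pi_n at the jumps. *)

Section PointwiseDerive.
Variables (K : numFieldType) (V : normedModType K).
Implicit Types (f g : V -> K) (x v : V).

Lemma is_derive_ext f g x v (d : K) :
  (forall u, f u = g u) -> is_derive x v f d -> is_derive x v g d.
Proof. by move=> /funext ->. Qed.

Lemma is_derive_addf f g x v (a b : K) :
  is_derive x v f a -> is_derive x v g b -> is_derive x v (fun u => f u + g u) (a + b).
Proof. exact: is_deriveD. Qed.

Lemma is_derive_subf f g x v (a b : K) :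
  is_derive x v f a -> is_derive x v g b -> is_derive x v (fun u => f u - g u) (a - b).
Proof. exact: is_deriveB. Qed.

Lemma is_derive_oppf f x v (a : K) :
  is_derive x v f a -> is_derive x v (fun u => - f u) (- a).
Proof. exact: is_deriveN. Qed.

Lemma is_derive_mulf f g x v (a b : K) :
  is_derive x v f a -> is_derive x v g b ->
  is_derive x v (fun u => f u * g u : K) (a * g x + f x * b).
Proof.
move=> df dg; apply: (is_derive_eq (is_deriveM df dg)).
by rewrite addrC; congr (_ + _); rewrite [LHS]mulrC.
Qed.

Lemma is_derive_scalef (c : K) f x v (a : K) :
  is_derive x v f a -> is_derive x v (fun u => c * f u : K) (c * a).
Proof. by move=> df; exact: is_deriveZ. Qed.

Lemma is_derive_invf f x v (a : K) : f x != 0 ->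
  is_derive x v f a -> is_derive x v (fun u => (f u)^-1 : K) (- a / f x ^+ 2).
Proof.
move=> fx [df <-]; apply: DeriveDef; first exact: (@derivableV _ _ f).
rewrite (@deriveV _ _ f)// mulNr mulrC -mulNr.
by [].
Qed.

Lemma is_derive_expf f n x v (a : K) : is_derive x v f a ->
  is_derive x v (fun u => f u ^+ n : K) (n%:R * f x ^+ n.-1 * a).
Proof. by move=> df; apply: (is_derive_ext _ (is_deriveX n df)) => u; rewrite exprfctE. Qed.

Lemma is_derive_sumf (I : Type) (r : seq I) (P : pred I) (h : I -> V -> K) x v (dh : I -> K) :
  (forall i, P i -> is_derive x v (h i) (dh i)) ->
  is_derive x v (fun u => \sum_(i <- r | P i) h i u : K) (\sum_(i <- r | P i) dh i).
Proof.
move=> H; elim: r => [|i r IH].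
  by rewrite big_nil; apply: (is_derive_ext _ (is_derive_cst 0 x v)) => u; rewrite big_nil.
rewrite big_cons; under eq_fun do rewrite big_cons.
by case: ifP => // Pi; apply: is_derive_addf => //; exact: H.
Qed.

End PointwiseDerive.

(** * Integration against the jump weight *)

Section GaussDominated.
Context {R : realType}.
Notation mu := (@lebesgue_measure R).
Implicit Types (f g F : R -> R) (s t : R).

(* One dominating function for all integrands: it absorbs the polynomial factors of
   e^(-t^2). *)
Definition hgauss (t : R) : R := expR (- t ^+ 2 / 2).

Definition gauss_dominated f :=
  measurable_fun setT f /\ exists C, forall t, `|f t| <= C * hgauss t.

Lemma hgauss_gt0 t : 0 < hgauss t. Proof. exact: expR_gt0. Qed.

(** [hgauss] is the standard normal density without its normalising constant. *)
Lemma hgauss_integrable : mu.-integrable setT (EFin \o hgauss).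
Proof.
have := @integrable_normal_pdf R 0 1.
have := normal_peak_gt0 (oner_neq0 R); set c := normal_peak 1 => c0 H.
have -> : hgauss = fun t => c^-1 * normal_pdf 0 1 t.
  apply/funext => t; rewrite normal_pdfE ?oner_eq0// /normal_fun /hgauss -/c.
  rewrite mulrA mulVf ?gt_eqF// mul1r; congr expR.
  by rewrite subr0 expr1n mulNr.
have := integrableZl measurableT c^-1 H.
by apply: eq_integrable => // t _ /=.
Qed.

Lemma gauss_dominated_integrable f : gauss_dominated f ->
  mu.-integrable setT (EFin \o f).
Proof.
move=> [mf [C Cf]].
apply: (le_integrable measurableT _ _ (integrableZl measurableT C hgauss_integrable)).
  exact/measurable_EFinP.
move=> t _ /=; rewrite lee_fin.
by rewrite (le_trans (Cf t))// ler_norm.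
Qed.

Lemma gauss_dominatedD f g : gauss_dominated f -> gauss_dominated g ->
  gauss_dominated (fun t => f t + g t).
Proof.
move=> [mf [C Cf]] [mg [D Dg]]; split; first exact: measurable_funD.
exists (C + D) => t; rewrite mulrDl.
by apply: (le_trans (ler_normD _ _)); apply: lerD.
Qed.

Lemma gauss_dominatedM f g (B : R) : measurable_fun setT g -> (forall t, `|g t| <= B) ->
  gauss_dominated f -> gauss_dominated (fun t => f t * g t).
Proof.
move=> mg gB [mf [C Cf]]; split; first exact: measurable_funM.
exists (C * B) => t; rewrite normrM mulrAC.
by apply: ler_pM.
Qed.

Lemma gauss_dominatedZ f (c : R) : gauss_dominated f -> gauss_dominated (fun t => c * f t).
Proof.
move=> df; have -> : (fun t => c * f t) = (fun t => f t * c).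
  by apply/funext => t; rewrite mulrC.
exact: (@gauss_dominatedM f (fun=> c) `|c|).
Qed.

Lemma gauss_dominatedN f : gauss_dominated f -> gauss_dominated (fun t => - f t).
Proof.
move=> /(gauss_dominatedZ (-1)); congr gauss_dominated; apply/funext => t.
by rewrite mulN1r.
Qed.

(** With v = t^2 / 2, half of the Gaussian is kept as [hgauss]; the other half, e^(-v), absorbs
    |t|^k <= 1 + t^(2k), because v^k / k! <= e^v. This gives the constant 1 + 2^k k!. *)
Lemma gauss_dominated_monomial k : gauss_dominated (fun t => t ^+ k * expR (- t ^+ 2)).
Proof.
split.
  apply: measurable_funM => //; apply: measurableT_comp => //.
  exact: measurableT_comp.
exists (1 + 2 ^+ k * k`!%:R) => t.
have -> : expR (- t ^+ 2) = hgauss t * hgauss t :> R.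
  by rewrite /hgauss -expRD; congr expR; lra.
rewrite normrM (ger0_norm (mulr_ge0 _ _)) ?expR_ge0// mulrA.
rewrite ler_pM2r ?hgauss_gt0//.
have : `|t ^+ k| <= 1 + (t ^+ 2) ^+ k.
  rewrite -exprM mulnC exprM; set u := t ^+ k.
  rewrite -real_normK ?num_real//; have := normr_ge0 u; move: `|u| => v v0; nra.
have : (t ^+ 2) ^+ k <= 2 ^+ k * k`!%:R * expR (t ^+ 2 / 2).
  set v := t ^+ 2 / 2; have -> : t ^+ 2 = 2 * v by rewrite /v; lra.
  have v0 : 0 <= v by rewrite divr_ge0// sqr_ge0.
  rewrite exprMn -mulrA ler_pM2l ?exprn_gt0//.
  case: k => [|k]; first by rewrite expr0 fact0 mul1r -expR0 ler_expR.
  have := expR_ge1Dxn k v0.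
  rewrite -ler_pdivrMl ?ltr0n ?fact_gt0// mulrC; lra.
have : 1 <= expR (t ^+ 2 / 2) by rewrite -expR0 ler_expR divr_ge0// sqr_ge0.
have -> : hgauss t = (expR (t ^+ 2 / 2))^-1 by rewrite -expRN /hgauss mulNr.
move: (expR _) (2 ^+ k * _) ((t ^+ 2) ^+ k) => e c p e1 pc tp.
rewrite ler_pdivrMr; last by lra.
by apply: (le_trans tp); rewrite mulrDl mul1r; lra.
Qed.


Lemma gauss_dominated_poly (q : {poly R}) :
  gauss_dominated (fun t => q.[t] * expR (- t ^+ 2)).
Proof.
(* The free factor t^k absorbs the ['X] that the induction on [q * 'X + c] splits off. *)
suff H k : gauss_dominated (fun t => q.[t] * (t ^+ k * expR (- t ^+ 2))).
  have := H 0; congr gauss_dominated; apply/funext => t.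
  by rewrite expr0 mul1r.
elim/poly_ind: q k => [|q c IH] k.
  have := gauss_dominatedZ 0 (gauss_dominated_monomial k).
  by congr gauss_dominated; apply/funext => t; rewrite horner0.
have := gauss_dominatedD (IH k.+1) (gauss_dominatedZ c (gauss_dominated_monomial k)).
congr gauss_dominated; apply/funext => t; rewrite hornerMXaddC [t ^+ k.+1]exprS.
ring.
Qed.

Lemma hgauss_nat n : hgauss (n%:R : R) <= 2 / n.+1%:R.
Proof.
have -> : hgauss n%:R = (expR (n%:R ^+ 2 / 2))^-1 :> R by rewrite -expRN /hgauss mulNr.
rewrite -[leRHS]invf_div lef_pV2 ?posrE ?expR_gt0 ?divr_gt0//.
apply: le_trans (expR_ge1Dx _).
rewrite ler_pdivrMr// -natr1; have := ler0n R n; move: (n%:R : R) => x x0; nra.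
Qed.

(** Half-lines are moved to infinity through integer endpoints only, so a bound of order 1/n is
    enough. *)
Lemma gauss_dominated_cvg F : gauss_dominated F ->
  (F n%:R @[n --> \oo] --> 0) /\ (F (- n%:R) @[n --> \oo] --> 0).
Proof.
move=> [_ [C FC]].
have H : `|C| * 2 * (n.+1%:R)^-1 @[n --> \oo] --> (0 : R).
  by rewrite -[X in _ --> X](mulr0 (`|C| * 2)); apply: cvgMr; exact: cvg_harmonic.
have B n : C * hgauss n%:R <= `|C| * 2 * (n.+1%:R)^-1.
  rewrite -mulrA (@le_trans _ _ (`|C| * hgauss n%:R))//.
    by rewrite ler_wpM2r ?(ltW (hgauss_gt0 _))// ler_norm.
  by rewrite ler_wpM2l// hgauss_nat.
have sq (u : R^nat) : (forall n, `|u n| <= C * hgauss n%:R) -> u @ \oo --> 0.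
  move=> uC; apply: norm_cvg0.
  apply: (@squeeze_cvgr _ _ _ _ (fun=> 0) (fun n => `|C| * 2 * (n.+1%:R)^-1)) => //.
    by apply: nearW => n; rewrite normr_ge0 (le_trans (uC n)).
  exact: cvg_cst.
by split; apply: sq => n; rewrite (le_trans (FC _))// /hgauss sqrrN.
Qed.

Lemma gauss_dominated_dct f (A_ : nat -> set R) (A : set R) :
  gauss_dominated f -> (forall n, measurable (A_ n)) -> measurable A ->
  (forall t, \forall n \near \oo, (t \in A_ n) = (t \in A)) ->
  \int[mu]_(t in A_ n) f t @[n --> \oo] --> \int[mu]_(t in A) f t.
Proof.
move=> df mA_ mA AA; have fi := gauss_dominated_integrable df.
have [mf _] := df.
have := @dominated_convergence _ _ R mu setT measurableT
  (fun n => EFin \o (f \_ (A_ n))) (EFin \o (f \_ A)) (EFin \o (Num.norm \o f)).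
case.
- move=> n; apply/measurable_EFinP; apply/(measurable_restrictT _ (mA_ n)).
  exact: measurable_funTS.
- apply/measurable_EFinP; apply/(measurable_restrictT _ mA).
  exact: measurable_funTS.
- apply: aeW => t _; apply: (@cvg_near_cst _ _ _ _ _ _).
  near=> n; rewrite /= !patchE; congr (if _ then _ else _)%:E.
  by near: n; exact: AA.
- exact: integrable_norm.
- apply: aeW => t n _ /=; rewrite lee_fin patchE.
  by case: ifP; rewrite ?normr0.
move=> fAi _ H.
have -> : (fun n => \int[mu]_(t in A_ n) f t) = fine \o (fun n => (\int[mu]_t (f \_ (A_ n) t)%:E)%E).
  by apply/funext => n; rewrite Rintegral_mkcond.
rewrite Rintegral_mkcond /Rintegral.
apply: fine_cvg; rewrite fineK//.
exact: integrable_fin_num.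
Unshelve. all: by end_near. Qed.

Lemma gauss_dominated_itv_derive f (s : R) : gauss_dominated f -> continuous f ->
  is_derive s 1 (fun s => \int[mu]_(t in `]-oo, s]) f t) (f s).
Proof.
move=> df cf.
have fi : mu.-integrable `]-oo, (s + 1)] (EFin \o f).
  by apply: integrableS (gauss_dominated_integrable df).
have s1 : s < s + 1 by rewrite ltrDl.
have [|D E] := @continuous_FTC1 R f -oo%O s (s + 1) s1 fi _ (cf s); first exact: ltNyr.
by rewrite -E derive1E; exact: derivableP.
Qed.

(** The integral of [f] from -oo and [F] have the same derivative, and their constant difference is
    0 because both vanish along -n. Letting the endpoint run through n, where [F] vanishes too,
    gives the integral over the line. *)
Lemma gauss_dominated_FTC f F : gauss_dominated f -> gauss_dominated F ->
  continuous f -> (forall t : R, is_derive t 1 F (f t)) ->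
  (forall s, \int[mu]_(t in `]-oo, s]) f t = F s) /\ \int[mu]_t f t = 0.
Proof.
move=> df dF cf DF.
pose G s := \int[mu]_(t in `]-oo, s]) f t.
have DG s : is_derive s 1 G (f s) by exact: gauss_dominated_itv_derive.
have [Fp Fm] := gauss_dominated_cvg dF.
have GF s : G s - F s = G 0 - F 0.
  apply: (@is_derive_0_is_cst R (fun s => G s - F s)) => t.
  rewrite -[X in is_derive _ _ _ X](subrr (f t)).
  exact: is_deriveB.
have cm : G (- n%:R) @[n --> \oo] --> 0.
  rewrite -(Rintegral_set0 mu f).
  apply: gauss_dominated_dct => // t.
  near=> n; rewrite in_set0; apply/negbTE/negP; rewrite inE /= in_itv/= => tn.
  have : - t < n%:R by near: n; exact: nbhs_infty_gtr.
  by rewrite ltrNl ltNge tn.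
have cp : G n%:R @[n --> \oo] --> \int[mu]_t f t.
  apply: gauss_dominated_dct => // t.
  near=> n; rewrite in_setT; apply: mem_set; rewrite /= in_itv/=.
  by near: n; exact: nbhs_infty_ger.
have c0 : G 0 - F 0 = 0.
  have H : G (- n%:R) - F (- n%:R) @[n --> \oo] --> (0 : R).
    by rewrite -[X in _ --> X](subr0 0); exact: cvgB.
  apply: etrans (cvg_lim (@Rhausdorff R) H); apply/esym/cvg_lim => //.
  under eq_fun do rewrite GF; exact: cvg_cst.
have GFE s : G s = F s by apply/eqP; rewrite -subr_eq0 GF c0.
split => //.
apply: etrans (esym (cvg_lim (@Rhausdorff R) cp)) _; apply/cvg_lim => //.
by under eq_fun do rewrite GFE.
Unshelve. all: by end_near. Qed.

End GaussDominated.

Section WeightFunctional.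
Context {R : realType}.
Notation mu := (@lebesgue_measure R).
Variables (w1 w2 : R).
Implicit Types (f F : R -> R) (s t : R).

Definition step (s1 s2 t : R) : R := if t < s1 then 1 else if t < s2 then w1 else w2.

Lemma measurable_step s1 s2 : measurable_fun setT (step s1 s2).
Proof.
apply: measurable_fun_ifT => //; first exact: measurable_fun_ltr.
apply: measurable_fun_ifT => //; exact: measurable_fun_ltr.
Qed.

Lemma step_le s1 s2 t : `|step s1 s2 t| <= 1 + `|w1| + `|w2|.
Proof.
rewrite /step; have := normr_ge0 w1; have := normr_ge0 w2.
by case: ifP => _; [rewrite normr1|case: ifP => _]; lra.
Qed.

Lemma gauss_dominated_step s1 s2 f : gauss_dominated f ->
  gauss_dominated (fun t => f t * step s1 s2 t).
Proof. move=> df; apply: (gauss_dominatedM (measurable_step s1 s2) _ df).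
exact: step_le. Qed.

Lemma gauss_dominated_patch f A : measurable A -> gauss_dominated f ->
  gauss_dominated (f \_ A).
Proof.
move=> mA [mf [C fC]]; split.
  by apply/(measurable_restrictT _ mA); exact: measurable_funTS.
exists `|C| => t; rewrite patchE; case: ifP => _; last first.
  by rewrite normr0 mulr_ge0// ltW// hgauss_gt0.
by rewrite (le_trans (fC t))// ler_pM2r ?hgauss_gt0// ler_norm.
Qed.

(** For s1 < s2 the step function is w2 + (1 - w1) 1_(t < s1) + (w1 - w2) 1_(t < s2), both
    indicators being 1 to the left of s1. All dependence on the jumps then sits in the endpoints of
    half-lines. *)
Lemma Rintegral_step s1 s2 f : s1 < s2 -> gauss_dominated f ->
  \int[mu]_t (f t * step s1 s2 t) = w2 * \int[mu]_t f t
    + (1 - w1) * \int[mu]_(t in `]-oo, s1]) f t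
    + (w1 - w2) * \int[mu]_(t in `]-oo, s2]) f t.
Proof.
move=> s12 df.
(* The endpoint is a null set: closed half-lines suit differentiation, open ones match the strict
   inequalities of [step]. *)
have I s : \int[mu]_(t in `]-oo, s]) f t = \int[mu]_t (f \_ `]-oo, s[) t.
  rewrite -Rintegral_itv_bndo_bndc// -?Rintegral_mkcond//.
  by apply: integrableS (gauss_dominated_integrable df).
have P s : gauss_dominated (f \_ `]-oo, s[) by exact: gauss_dominated_patch.
rewrite !I -!RintegralZl//; do ?exact: gauss_dominated_integrable.
rewrite -!RintegralD//; do ?
  by apply: gauss_dominated_integrable; do ?apply: gauss_dominatedD;
  apply: gauss_dominatedZ.
apply: eq_Rintegral => t _; rewrite !patchE /step !mem_setE !in_itv/= (_ : point = 0 :> R)//.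
have [ts1|ts1] := ltP t s1; first by rewrite (lt_trans ts1 s12); lra.
by have [|] := ltP t s2; lra.
Qed.

(** The jumps move along arbitrary curves, so that one statement serves both the joint shift in x
    and the separate variations of s1 and s2 in F. *)
Lemma is_derive_Rintegral_step f (c1 c2 : R -> R) (d1 d2 u : R) :
  gauss_dominated f -> continuous f ->
  is_derive u 1 c1 d1 -> is_derive u 1 c2 d2 ->
  (\forall v \near u, c1 v < c2 v) ->
  is_derive u 1 (fun v => \int[mu]_t (f t * step (c1 v) (c2 v) t))
    ((1 - w1) * f (c1 u) * d1 + (w1 - w2) * f (c2 u) * d2).
Proof.
move=> df cf D1 D2 c12.
pose G s := \int[mu]_(t in `]-oo, s]) f t.
apply: (@near_eq_is_derive _ _ _ (fun v => w2 * \int[mu]_t f t + (1 - w1) * G (c1 v) + (w1 - w2) * G (c2 v))).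
  by near=> v; rewrite Rintegral_step//; near: v.
have DG (c : R -> R) (d : R) : is_derive u 1 c d -> is_derive u 1 (fun v => G (c v)) (f (c u) * d).
  by move=> Dc; apply: (@is_derive1_comp _ G c); exact: gauss_dominated_itv_derive.
have DG1 := DG _ _ D1; have DG2 := DG _ _ D2.
rewrite -!mulrA -[X in is_derive _ _ _ (X + _)]add0r.
exact: (is_derive_addf (is_derive_addf (is_derive_cst _ _ _)
  (is_derive_scalef _ DG1)) (is_derive_scalef _ DG2)).
Unshelve. all: by end_near. Qed.

Lemma Rintegral_step_FTC s1 s2 f F : s1 < s2 -> gauss_dominated f -> gauss_dominated F ->
  continuous f -> (forall t : R, is_derive t 1 F (f t)) ->
  \int[mu]_t (f t * step s1 s2 t) = (1 - w1) * F s1 + (w1 - w2) * F s2.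
Proof.
move=> s12 df dF cf DF; have [I I0] := gauss_dominated_FTC df dF cf DF.
by rewrite Rintegral_step// I0 !I mulr0 add0r.
Qed.

Definition wfun (s1 s2 : R) (q : {poly R}) : R :=
  \int[mu]_t (q.[t] * weight s1 s2 w1 w2 t).

Lemma weightE s1 s2 (q t : R) :
  q * weight s1 s2 w1 w2 t = q * expR (- t ^+ 2) * step s1 s2 t.
Proof. by rewrite /weight mulrA. Qed.

Lemma gauss_dominated_weight s1 s2 (q : {poly R}) :
  gauss_dominated (fun t => q.[t] * weight s1 s2 w1 w2 t).
Proof.
under eq_fun do rewrite weightE.
exact/gauss_dominated_step/gauss_dominated_poly.
Qed.

Lemma wfun_is_linear s1 s2 : scalar (wfun s1 s2).
Proof.
move=> a p q; rewrite /wfun.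
rewrite -RintegralZl//; last exact/gauss_dominated_integrable/gauss_dominated_weight.
rewrite -RintegralD//; do ?exact/gauss_dominated_integrable/gauss_dominatedZ/gauss_dominated_weight.
  by apply: eq_Rintegral => t _; rewrite hornerD hornerZ mulrDl -mulrA.
exact/gauss_dominated_integrable/gauss_dominated_weight.
Qed.

HB.instance Definition _ s1 s2 :=
  GRing.isLinear.Build R {poly R} R *%R (wfun s1 s2) (wfun_is_linear s1 s2).

Lemma is_derive_gauss_poly (q : {poly R}) (t : R) :
  is_derive t 1 (fun t => q.[t] * expR (- t ^+ 2)) ((q^`() - 2 *: 'X * q).[t] * expR (- t ^+ 2)).
Proof.
apply: is_derive_eq.
rewrite !(hornerD, hornerN, hornerM, hornerZ, hornerX) /GRing.scale/=; ring.
Qed.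

Lemma continuous_gauss_poly (q : {poly R}) : continuous (fun t => q.[t] * expR (- t ^+ 2)).
Proof.
move=> t; apply/differentiable_continuous/derivable1_diffP.
by have [] := is_derive_gauss_poly q t.
Qed.

Lemma is_derive_wfun (c1 c2 : R -> R) (d1 d2 u : R) (q : {poly R}) :
  is_derive u 1 c1 d1 -> is_derive u 1 c2 d2 ->
  (\forall v \near u, c1 v < c2 v) ->
  is_derive u 1 (fun v => wfun (c1 v) (c2 v) q)
    ((1 - w1) * (q.[c1 u] * expR (- c1 u ^+ 2)) * d1
     + (w1 - w2) * (q.[c2 u] * expR (- c2 u ^+ 2)) * d2).
Proof.
move=> D1 D2 c12.
have := is_derive_Rintegral_step (gauss_dominated_poly q) (@continuous_gauss_poly q) D1 D2 c12.
apply: is_derive_ext => v; apply: eq_Rintegral => t _.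
by rewrite weightE.
Qed.

Lemma wfun_pearson s1 s2 (q : {poly R}) : s1 < s2 ->
  wfun s1 s2 (q^`() - 2 *: 'X * q) =
    (1 - w1) * (q.[s1] * expR (- s1 ^+ 2)) + (w1 - w2) * (q.[s2] * expR (- s2 ^+ 2)).
Proof.
move=> s12; rewrite -(Rintegral_step_FTC s12 (gauss_dominated_poly (q^`() - 2 *: 'X * q))
  (gauss_dominated_poly q) (@continuous_gauss_poly _) (is_derive_gauss_poly q)).
by apply: eq_Rintegral => t _; rewrite weightE.
Qed.

End WeightFunctional.

(** * Cauchy transforms *)

Section ComplexIntegral.
Context {R : realType}.
Notation mu := (@lebesgue_measure R).
Notation C := (R[i]).
Implicit Types (f g : R -> C) (z : C) (t : R).

Lemma complex_ReM (z z' : C) : complex.Re (z * z') = complex.Re z * complex.Re z' - complex.Im z * complex.Im z'.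
Proof. by case: z z' => [a b] [c d]. Qed.
Lemma complex_ImM (z z' : C) : complex.Im (z * z') = complex.Re z * complex.Im z' + complex.Im z * complex.Re z'.
Proof. by case: z z' => [a b] [c d]. Qed.
Lemma complex_ReD (z z' : C) : complex.Re (z + z') = complex.Re z + complex.Re z'.
Proof. by case: z z' => [a b] [c d]. Qed.
Lemma complex_ImD (z z' : C) : complex.Im (z + z') = complex.Im z + complex.Im z'.
Proof. by case: z z' => [a b] [c d]. Qed.
Lemma complex_ReN (z : C) : complex.Re (- z) = - complex.Re z.
Proof. by case: z => [a b]. Qed.
Lemma complex_ImN (z : C) : complex.Im (- z) = - complex.Im z.
Proof. by case: z => [a b]. Qed.
Lemma complex_eqP (z z' : C) : complex.Re z = complex.Re z' -> complex.Im z = complex.Im z' -> z = z'.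
Proof. by case: z z' => [a b] [c d] /= -> ->. Qed.

Definition cgauss_dominated f :=
  gauss_dominated (fun t => complex.Re (f t)) /\ gauss_dominated (fun t => complex.Im (f t)).

Lemma cgauss_dominatedD f g : cgauss_dominated f -> cgauss_dominated g ->
  cgauss_dominated (fun t => f t + g t).
Proof.
move=> [f1 f2] [g1 g2]; split.
  by under eq_fun do rewrite complex_ReD; exact: gauss_dominatedD.
by under eq_fun do rewrite complex_ImD; exact: gauss_dominatedD.
Qed.

Lemma cgauss_dominatedZ z f : cgauss_dominated f -> cgauss_dominated (fun t => z * f t).
Proof.
move=> [f1 f2]; split.
  under eq_fun do rewrite complex_ReM -mulNr; apply: gauss_dominatedD; exact: gauss_dominatedZ.
under eq_fun do rewrite complex_ImM; apply: gauss_dominatedD; exact: gauss_dominatedZ.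
Qed.

Lemma cintegralD f g : cgauss_dominated f -> cgauss_dominated g ->
  cintegral (fun t => f t + g t) = cintegral f + cintegral g.
Proof.
move=> [f1 f2] [g1 g2]; apply: complex_eqP => /=.
  by under eq_fun do rewrite complex_ReD; rewrite RintegralD//; exact: gauss_dominated_integrable.
by under eq_fun do rewrite complex_ImD; rewrite RintegralD//; exact: gauss_dominated_integrable.
Qed.

Lemma cintegralZ z f : cgauss_dominated f -> cintegral (fun t => z * f t) = z * cintegral f.
Proof.
move=> [f1 f2]; have I1 := gauss_dominated_integrable f1.
have I2 := gauss_dominated_integrable f2.
have Z1 c := gauss_dominated_integrable (gauss_dominatedZ c f1).
have Z2 c := gauss_dominated_integrable (gauss_dominatedZ c f2).
apply: complex_eqP; rewrite ?complex_ReM ?complex_ImM /=.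
  by under eq_fun do rewrite complex_ReM; rewrite RintegralB// !RintegralZl.
by under eq_fun do rewrite complex_ImM; rewrite RintegralD// !RintegralZl.
Qed.

Lemma eq_cintegral f g : (forall t, f t = g t) -> cintegral f = cintegral g.
Proof. by move=> /funext ->. Qed.

Lemma norm_complex_le (z : C) : `|z| <= (`|complex.Re z| + `|complex.Im z|)%:C.
Proof.
rewrite [in leLHS](complexE z) (le_trans (ler_normD _ _))// rmorphD/= lerD//.
  by rewrite normc_def/= expr0n addr0 sqrtr_sqr.
by rewrite normrM normc_def/= expr0n add0r expr1n sqrtr1 mul1r normc_def/= expr0n addr0 sqrtr_sqr.
Qed.

Lemma Re_le_norm (z : C) : (`|complex.Re z|)%:C <= `|z|.
Proof. exact: normc_ge_Re. Qed.

Lemma Im_le_norm (z : C) : (`|complex.Im z|)%:C <= `|z|.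
Proof.
rewrite normc_def lecR -sqrtr_sqr ler_wsqrtr// lerDr sqr_ge0//.
Qed.

(** Real and imaginary parts are bounded separately. The resulting factor 2 is harmless, since the
    bound only has to control a quadratic remainder. *)
Lemma cintegral_le (B : R) f : cgauss_dominated f ->
  (forall t, `|f t| <= (B * hgauss t)%:C) ->
  `|cintegral f| <= (2 * B * \int[mu]_t hgauss t)%:C.
Proof.
move=> [f1 f2] fB.
have H (g : R -> R) : gauss_dominated g -> (forall t, `|g t| <= B * hgauss t) ->
    `|\int[mu]_t g t| <= B * \int[mu]_t hgauss t.
  move=> dg gB; have ig := gauss_dominated_integrable dg.
  apply: (le_trans (le_normr_Rintegral _ ig)) => //.
  rewrite -RintegralZl//; last exact: hgauss_integrable.
  apply: le_Rintegral => //; first exact: integrable_norm.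
  by have := integrableZl measurableT B (@hgauss_integrable R).
apply: (le_trans (norm_complex_le _)); rewrite lecR /=.
rewrite -mulrA mulr_natl mulr2n.
apply: lerD; apply: H => // t; rewrite -lecR.
  exact: le_trans (Re_le_norm _) (fB t).
exact: le_trans (Im_le_norm _) (fB t).
Qed.

End ComplexIntegral.

(** * Complex differentiation and the exponential *)

Lemma is_derive_compf (K : numFieldType) (f g : K -> K) (x a b : K) :
  is_derive x 1 g a -> is_derive (g x) 1 f b -> is_derive x 1 (fun u => f (g u)) (b * a).
Proof.
move=> [dg <-] [df <-].
have dg' : differentiable g x by apply/derivable1_diffP.
have df' : differentiable f (g x) by apply/derivable1_diffP.
have dfg : differentiable (f \o g) x by exact: differentiable_comp.
apply: DeriveDef; first exact/derivable1_diffP.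
rewrite [LHS]deriveE// diff_comp//= !deriveE//.
by rewrite -[X in 'd _ _ X = _]mulr1 [LHS]linearZ mulrC.
Qed.

Section ComplexDerivative.
Context {R : realType}.
Notation C := (R[i]).

(* The ascriptions to C^o give C its structure of normed module over itself. *)
Definition is_cderive (f : C -> C) (z d : C) : Prop :=
  is_derive (z : C^o) (1 : C^o) (f : C^o -> C^o) d.

(** The difference quotient is off by at most K |h|. Both the exponential and the Cauchy transforms
    have an explicit remainder of order h^2, so no general theorem on differentiation under the
    integral is called for. *)
Lemma is_cderive_quad (f : C -> C) (z d : C) (e K : R) : 0 < e ->
  (forall h : C, `|h| < e%:C -> `|f (z + h) - f z - h * d| <= K%:C * `|h| ^+ 2) ->
  is_cderive f z d.
Proof.
move=> e0 H.
have L : (fun h : C^o => h^-1 *: ((f : C^o -> C^o) (h *: (1 : C^o) + (z : C^o)) - f z)) @ (0 : C^o)^' --> (d : C^o).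
  apply/cvgrPdist_lt => /= eps eps0.
  have K0 : 0 < `|K%:C| + 1 :> C by rewrite ltr_pwDr// normr_ge0.
  near=> h.
  have h0 : h != 0 :> C by near: h; exact: nbhs_dnbhs_neq.
  have he : `|h : C| < e%:C by near: h; apply: dnbhs0_lt; rewrite ltcR.
  have hk : `|h : C| < eps / (`|K%:C| + 1).
    by near: h; apply: dnbhs0_lt; rewrite divr_gt0.
  have -> : (d : C) - (h : C)^-1 * (f ((h : C) * 1 + z) - f z) = - (h^-1 * (f (z + h) - f z - h * d)).
    by rewrite mulr1 [h + z]addrC [in RHS]mulrBr mulKf// opprB.
  rewrite normrN normrM normfV mulrC ltr_pdivrMr ?normr_gt0//.
  apply: (le_lt_trans (H _ he)); rewrite expr2 mulrA ltr_pM2r ?normr_gt0//.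
  rewrite ltr_pdivlMr// in hk; apply: le_lt_trans hk.
  rewrite [leLHS]mulrC ler_wpM2l//.
  have KR : K%:C \is Num.real by apply/complex_realP; exists K.
  by rewrite (le_trans (real_ler_norm KR))// lerDl.
apply: DeriveDef; first by apply/cvg_ex; exists d.
exact/cvg_lim.
Unshelve. all: by end_near. Qed.

Lemma is_cderive_derive1 (f : C -> C) (z d : C) : is_cderive f z d ->
  derive1 (f : C^o -> C^o) z = d.
Proof. by move=> [_ <-]; rewrite derive1E. Qed.

Lemma is_cderiveD f g (z a b : C) : is_cderive f z a -> is_cderive g z b ->
  is_cderive (fun u => f u + g u) z (a + b).
Proof. exact: is_derive_addf. Qed.

Lemma is_cderiveM f g (z a b : C) : is_cderive f z a -> is_cderive g z b ->
  is_cderive (fun u => f u * g u) z (a * g z + f z * b).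
Proof. exact: is_derive_mulf. Qed.

Lemma is_cderiveZ (c : C) f (z a : C) : is_cderive f z a ->
  is_cderive (fun u => c * f u) z (c * a).
Proof. exact: is_derive_scalef. Qed.

Lemma is_cderive_cst (c z : C) : is_cderive (fun=> c) z 0.
Proof. exact: is_derive_cst. Qed.

Lemma is_cderive_id (z : C) : is_cderive id z 1.
Proof. exact: is_derive_id. Qed.

Lemma is_cderive_comp f g (z a b : C) : is_cderive g z a -> is_cderive f (g z) b ->
  is_cderive (fun u => f (g u)) z (b * a).
Proof.
exact: is_derive_compf.
Qed.

Lemma is_cderive_horner (q : {poly C}) (z : C) : is_cderive (horner q) z q^`().[z].
Proof.
elim/poly_ind: q => [|q c IH].
  by rewrite deriv0 horner0 (_ : horner 0 = fun=> 0); [exact: is_cderive_cst|apply/funext => u; rewrite horner0].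
rewrite (_ : horner _ = fun u => q.[u] * u + c); last by apply/funext => u; rewrite hornerMXaddC.
have := is_cderiveD (is_cderiveM IH (is_cderive_id z)) (is_cderive_cst c z).
by rewrite derivD derivM derivX derivC !(hornerD, hornerM, hornerX, hornerC) addr0.
Qed.

Lemma cexpD (z z' : C) : cexp (z + z') = cexp z * cexp z'.
Proof.
case: z z' => [a b] [c d]; rewrite /cexp /= expRD cosD sinD.
by apply: complex_eqP; rewrite /=; ring.
Qed.

Lemma cexp0 : cexp (0 : C) = 1.
Proof. by rewrite /cexp /= expR0 cos0 sin0 mul1r. Qed.

Lemma cexpN (z : C) : cexp (- z) * cexp z = 1.
Proof. by rewrite -cexpD addNr cexp0. Qed.

Lemma derive_bound_0 (f df : R -> R) (K b : R) : (forall x : R, is_derive x 1 f (df x)) ->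
  (forall c, `|c| <= `|b| -> `|df c| <= K) -> `|f b - f 0| <= K * `|b|.
Proof.
move=> Df dfK.
have cf (A : set R) : {within A, continuous f}.
  apply: continuous_subspaceT => x; apply/differentiable_continuous/derivable1_diffP.
  by have [] := Df x.
have [b0|b0] := leP 0 b.
  have [c] := @MVT_segment R f df 0 b b0 (fun x _ => Df x) (cf _).
  rewrite in_itv/= => /andP[c0 cb] ->; rewrite subr0 normrM ler_wpM2r// dfK//.
  by rewrite !ger0_norm.
have [c] := @MVT_segment R f df b 0 (ltW b0) (fun x _ => Df x) (cf _).
rewrite in_itv/= distrC => /andP[bc c0] ->; rewrite sub0r normrM normrN ler_wpM2r// dfK//.
by rewrite !ler0_norm ?lerN2// ltW.
Qed.

Lemma sin_le_norm (b : R) : `|sin b| <= `|b|.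
Proof.
have := @derive_bound_0 sin cos 1 b _ _; rewrite sin0 subr0 mul1r; apply => //.
by move=> c _; rewrite ler_norml cos_geN1 cos_le1.
Qed.

Lemma cos_sub1_le (b : R) : `|cos b - 1| <= b ^+ 2.
Proof.
rewrite -[b ^+ 2]real_normK ?num_real// expr2 -[X in cos b - X]cos0.
apply: (@derive_bound_0 cos (fun c => - sin c)) => //.
by move=> c cb; rewrite normrN (le_trans (sin_le_norm c)).
Qed.

Lemma sin_sub_le (b : R) : `|b| <= 1 -> `|sin b - b| <= b ^+ 2.
Proof.
move=> b1.
have D (x : R) : is_derive x 1 (fun c : R => sin c - c) (cos x - 1).
  exact: (is_derive_subf (is_derive_sin x) (is_derive_id x 1)).
have := @derive_bound_0 (fun c => sin c - c) (fun c => cos c - 1) (b ^+ 2) b D _.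
rewrite sin0 subr0 subr0 => H.
apply: le_trans (H _) _; last by rewrite ler_piMr// sqr_ge0.
move=> c cb; apply: (le_trans (cos_sub1_le c)).
by rewrite -[c ^+ 2]real_normK ?num_real// -[b ^+ 2]real_normK ?num_real// lerXn2r ?nnegrE.
Qed.

(** The upper bound comes from e^(-a) >= 1 - a, that is e^a <= 1 / (1 - a), whose excess over 1 + a
    is a^2 / (1 - a). *)
Lemma expR_sub_le (a : R) : `|a| <= 1 / 2 -> 0 <= expR a - 1 - a <= 2 * a ^+ 2.
Proof.
move=> a1; have := expR_ge1Dx a; have := expR_ge1Dx (- a).
rewrite expRN; have := expR_gt0 a; move: (expR a) => e e0 H1 H2.
move: a1; rewrite ler_norml => /andP[a2 a3].
have : (1 - a) * e <= 1 by rewrite -ler_pdivlMr// div1r.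
by move=> H; apply/andP; split; first lra; nra.
Qed.

(** For h = a + ib the real part contributes at most 2 a^2 + 2 b^2 and the imaginary part at most 2
    |a| |b| + b^2 <= a^2 + 2 b^2; hence the constant 4. *)
Lemma cexp_quad (h : C) : `|h| < (1 / 2 : R)%:C -> `|cexp h - 1 - h| <= (4 : R)%:C * `|h| ^+ 2.
Proof.
case: h => a b hh; rewrite -add_Re2_Im2 -rmorphM/=.
have a2 : `|a| <= 1 / 2 by rewrite -lecR (le_trans (Re_le_norm (a +i* b)))// ltW.
have b2 : `|b| <= 1 / 2 by rewrite -lecR (le_trans (Im_le_norm (a +i* b)))// ltW.
apply: (le_trans (norm_complex_le _)); rewrite lecR /cexp /= !mul0r subr0 addr0 subr0.
have /andP[E1 E2] := expR_sub_le a2.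
have C1 := cos_sub1_le b; have S1 := sin_le_norm b.
have S2 : `|sin b - b| <= b ^+ 2 by apply: sin_sub_le; lra.
have -> : expR a * cos b - 1 - a = (expR a - 1 - a) + expR a * (cos b - 1) by ring.
have -> : expR a * sin b - b = (expR a - 1) * sin b + (sin b - b) by ring.
have e2 : expR a <= 2.
  by move: a2; rewrite ler_norml => /andP[? ?]; nra.
have e1 : `|expR a - 1| <= 2 * `|a|.
  have -> : expR a - 1 = (expR a - 1 - a) + a by ring.
  apply: (le_trans (ler_normD _ _)); rewrite ger0_norm//.
  have := real_normK (num_real a) => aa; have := normr_ge0 a; nra.
apply: (le_trans (lerD (ler_normD _ _) (ler_normD _ _))).
rewrite !normrM (ger0_norm E1) (ger0_norm (expR_ge0 a)).
have A1 : expR a * `|cos b - 1| <= 2 * b ^+ 2 by rewrite ler_pM// expR_ge0.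
have A2 : `|expR a - 1| * `|sin b| <= 2 * `|a| * `|b| by rewrite ler_pM.
have : 2 * `|a| * `|b| <= a ^+ 2 + b ^+ 2.
  rewrite -[a ^+ 2]real_normK ?num_real// -[b ^+ 2]real_normK ?num_real//.
  by have := sqr_ge0 (`|a| - `|b|); nra.
have := sqr_ge0 a; have := sqr_ge0 b; lra.
Qed.

Lemma is_cderive_cexp (z : C) : is_cderive (@cexp R) z (cexp z).
Proof.
have /complex_realP[K KE] : `|cexp z| * 4 \is Num.real by rewrite realM ?normr_real ?realn.
apply: (@is_cderive_quad _ _ _ (1 / 2) K); first by lra.
move=> h hh; rewrite cexpD.
have -> : cexp z * cexp h - cexp z - h * cexp z = cexp z * (cexp h - 1 - h) by ring.
rewrite normrM -KE -mulrA ler_wpM2l//.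
by apply: (le_trans (cexp_quad hh)); rewrite rmorph_nat.
Qed.

End ComplexDerivative.

(** * The resolvent kernel and derivatives of Cauchy transforms *)

Section Resolvent.
Context {R : realType}.
Notation C := (R[i]).
Implicit Types (z : C) (t : R).

Definition resolvent z t : C := (t%:C - z)^-1.

Lemma resolvent_den_neq0 z t : complex.Im z != 0 -> t%:C - z != 0.
Proof.
move=> bz; apply: contra bz => /eqP/(congr1 (@complex.Im R)).
by case: z => a b /= /eqP; rewrite sub0r oppr_eq0.
Qed.

Lemma resolvent_le z t : complex.Im z != 0 ->
  `|resolvent z t| <= (`|complex.Im z|^-1)%:C.
Proof.
move=> bz; rewrite /resolvent normfV fmorphV lef_pV2 ?posrE ?normr_gt0 ?resolvent_den_neq0//.
  have := Im_le_norm (t%:C - z); rewrite complex_ImD complex_ImN /= sub0r normrN; exact.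
by rewrite ltcR normr_gt0.
Qed.

Lemma is_derive_RC_mul (f g : R -> C) (t : R) (a b : C) :
  is_derive_RC f t a -> is_derive_RC g t b ->
  is_derive_RC (fun u => f u * g u) t (a * g t + f t * b).
Proof.
move=> [f1 f2] [g1 g2]; split.
  have D := is_derive_subf (is_derive_mulf f1 g1) (is_derive_mulf f2 g2).
  apply: is_derive_eq (is_derive_ext (g := fun u => complex.Re (f u * g u)) _ D) _.
    by move=> u; rewrite complex_ReM.
  rewrite complex_ReD !complex_ReM; ring.
have D := is_derive_addf (is_derive_mulf f1 g2) (is_derive_mulf f2 g1).
apply: is_derive_eq (is_derive_ext (g := fun u => complex.Im (f u * g u)) _ D) _.
  by move=> u; rewrite complex_ImM.
rewrite complex_ImD !complex_ImM; ring.
Qed.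

Lemma is_derive_RC_real (f : R -> R) (t a : R) : is_derive t 1 f a ->
  is_derive_RC (fun u => (f u)%:C) t a%:C.
Proof. by move=> df; split => //=; exact: is_derive_cst. Qed.

Lemma resolventE (a b t : R) : resolvent (a +i* b) t =
  ((t - a) / ((t - a) ^+ 2 + b ^+ 2)) +i* (b / ((t - a) ^+ 2 + b ^+ 2)).
Proof. by apply: complex_eqP; rewrite /= sub0r sqrrN ?mulNr ?opprK. Qed.

Lemma is_derive_RC_resolvent z t : complex.Im z != 0 ->
  is_derive_RC (resolvent z) t (- resolvent z t ^+ 2).
Proof.
case: z => a b /= b0.
have D0 u : (u - a) ^+ 2 + b ^+ 2 != 0.
  by rewrite gt_eqF// ltr_wpDl ?sqr_ge0// exprn_even_gt0.
have dD : is_derive t 1 (fun u : R => (u - a) ^+ 2 + b ^+ 2) (2 * (t - a)).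
  have := is_derive_addf (is_derive_expf 2 (is_derive_subf (is_derive_id t 1) (is_derive_cst a t 1))) (is_derive_cst (b ^+ 2) t 1).
  by rewrite addr0 subr0 mulr1 expr1.
have dV := @is_derive_invf _ _ (fun u : R => (u - a) ^+ 2 + b ^+ 2) t 1 _ (D0 t) dD.
split.
  have := is_derive_mulf (is_derive_subf (is_derive_id t 1) (is_derive_cst a t 1)) dV.
  rewrite (_ : _ + _ = complex.Re (- resolvent (a +i* b) t ^+ 2)).
    by apply: is_derive_ext => u; rewrite resolventE.
  by rewrite resolventE complex_ReN expr2 complex_ReM /=; field; exact: D0.
have := is_derive_scalef b dV.
rewrite (_ : _ * _ = complex.Im (- resolvent (a +i* b) t ^+ 2)).
  by apply: is_derive_ext => u; rewrite resolventE.
by rewrite resolventE complex_ImN expr2 complex_ImM /=; field; exact: D0.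
Qed.

Definition RC_continuous (f : R -> C) :=
  continuous (fun t => complex.Re (f t)) /\ continuous (fun t => complex.Im (f t)).

Lemma is_derive_RC_continuous (f df : R -> C) :
  (forall t, is_derive_RC f t (df t)) -> RC_continuous f.
Proof.
move=> D; split=> t; apply/differentiable_continuous/derivable1_diffP.
  by have [[]] := D t.
by have [_ []] := D t.
Qed.

Lemma RC_continuousM (f g : R -> C) : RC_continuous f -> RC_continuous g ->
  RC_continuous (fun t => f t * g t).
Proof.
move=> [f1 f2] [g1 g2]; split=> t.
  under eq_fun do rewrite complex_ReM.
  by apply: cvgB; apply: cvgM; [exact: f1|exact: g1|exact: f2|exact: g2].
under eq_fun do rewrite complex_ImM.
by apply: cvgD; apply: cvgM; [exact: f1|exact: g2|exact: f2|exact: g1].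
Qed.

Lemma RC_continuousD (f g : R -> C) : RC_continuous f -> RC_continuous g ->
  RC_continuous (fun t => f t + g t).
Proof.
move=> [f1 f2] [g1 g2]; split=> t.
  by under eq_fun do rewrite complex_ReD; apply: cvgD; [exact: f1|exact: g1].
by under eq_fun do rewrite complex_ImD; apply: cvgD; [exact: f2|exact: g2].
Qed.

Lemma RC_continuous_real (f : R -> R) : continuous f -> RC_continuous (fun t => (f t)%:C).
Proof. by move=> cf; split => //= t; exact: cvg_cst. Qed.

Lemma RC_continuous_resolvent z : complex.Im z != 0 -> RC_continuous (resolvent z).
Proof. by move=> bz; apply: is_derive_RC_continuous => t; exact: is_derive_RC_resolvent. Qed.

Lemma cgauss_dominatedM (f : R -> R) (h : R -> C) (B : R) : gauss_dominated f ->
  RC_continuous h -> (forall t, `|h t| <= B%:C) ->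
  cgauss_dominated (fun t => (f t)%:C * h t).
Proof.
move=> df [h1 h2] hB; split.
  under eq_fun do rewrite complex_ReM /= mul0r subr0.
  apply: (@gauss_dominatedM _ _ _ B _ _ df); first exact: continuous_measurable_fun.
  by move=> t; rewrite -lecR; exact: le_trans (Re_le_norm _) (hB t).
under eq_fun do rewrite complex_ImM /= mul0r addr0.
apply: (@gauss_dominatedM _ _ _ B _ _ df); first exact: continuous_measurable_fun.
by move=> t; rewrite -lecR; exact: le_trans (Im_le_norm _) (hB t).
Qed.

End Resolvent.

Lemma norm_real_complex (R : realType) (x : R) : `|x%:C| = `|x|%:C.
Proof. by rewrite normc_def/= expr0n addr0 sqrtr_sqr. Qed.

Lemma norm_mul_le (R : realType) (x y : R[i]) (a b : R) :
  `|x| <= a%:C -> `|y| <= b%:C -> `|x * y| <= (a * b)%:C.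
Proof. by move=> xa yb; rewrite normrM rmorphM/= ler_pM. Qed.

Section CauchyTransform.
Context {R : realType}.
Notation C := (R[i]).
Variables (w1 w2 s1 s2 : R).
Hypothesis s12 : s1 < s2.
Notation w := (weight s1 s2 w1 w2).
Notation L := (wfun w1 w2 s1 s2).
Notation cauchy := (cauchy_int w).
Implicit Types (q r : {poly R}) (z : C).

Definition jump1 : R := (w1 - 1) * expR (- s1 ^+ 2).
Definition jump2 : R := (w2 - w1) * expR (- s2 ^+ 2).

Lemma cauchy_intE q z : cauchy q z = cintegral (fun t => (q.[t] * w t)%:C * resolvent z t).
Proof. by []. Qed.

Lemma cgauss_dominated_resolvent (f : R -> R) z : gauss_dominated f ->
  complex.Im z != 0 -> cgauss_dominated (fun t => (f t)%:C * resolvent z t).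
Proof.
move=> df bz; apply: (cgauss_dominatedM df (RC_continuous_resolvent bz)) => t.
exact: resolvent_le.
Qed.

Lemma cgauss_dominated_resolvent2 (f : R -> R) z z' : gauss_dominated f ->
  complex.Im z != 0 -> complex.Im z' != 0 ->
  cgauss_dominated (fun t => (f t)%:C * (resolvent z t * resolvent z' t)).
Proof.
move=> df bz bz'.
apply: (@cgauss_dominatedM _ _ _ (`|complex.Im z|^-1 * `|complex.Im z'|^-1) df).
  by apply: RC_continuousM; exact: RC_continuous_resolvent.
by move=> t; apply: norm_mul_le; exact: resolvent_le.
Qed.

Lemma cauchy_int_linear (a : R) q r z : complex.Im z != 0 ->
  cauchy (a *: q + r) z = a%:C * cauchy q z + cauchy r z.
Proof.
move=> bz; have d p := cgauss_dominated_resolvent (gauss_dominated_weight w1 w2 s1 s2 p) bz.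
rewrite !cauchy_intE -cintegralZ// -cintegralD//; last exact: cgauss_dominatedZ.
apply: eq_cintegral => t.
by rewrite hornerD hornerZ mulrDl rmorphD/= mulrDl -!mulrA rmorphM/= !mulrA.
Qed.

Lemma cintegral_real (f : R -> R) :
  cintegral (fun t => (f t)%:C) = (\int[@lebesgue_measure R]_t f t)%:C.
Proof.
rewrite /cintegral /=; congr Complex.
by rewrite /Rintegral integral0.
Qed.

(** Because t / (t - z) = z / (t - z) + 1. *)
Lemma cauchy_int_mulX q z : complex.Im z != 0 ->
  cauchy ('X * q) z = z * cauchy q z + (L q)%:C.
Proof.
move=> bz; have d p := cgauss_dominated_resolvent (gauss_dominated_weight w1 w2 s1 s2 p) bz.
have dw := gauss_dominated_weight w1 w2 s1 s2 q.
rewrite !cauchy_intE -cintegralZ// -cintegral_real -cintegralD//.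
- apply: eq_cintegral => t.
  have D0 := resolvent_den_neq0 t bz.
  rewrite hornerM hornerX /resolvent -mulrA rmorphM/=.
  move: (q.[t] * w t) D0 => u D0; field; exact: D0.
- exact: cgauss_dominatedZ.
- split => //=; have := gauss_dominatedZ 0 dw; congr gauss_dominated.
  by apply/funext => t; rewrite mul0r.
Qed.

(** The remainder is exact: 1 / (t - z - h) = 1 / (t - z) + h / (t - z)^2 + h^2 / ((t - z - h) (t -
    z)^2). For |h| below half the distance b from z to the axis, the first factor of the last
    denominator is at least b / 2 in modulus, uniformly in t. *)
Lemma cauchy_int_derivable q z : complex.Im z != 0 ->
  is_cderive (cauchy q) z (cintegral (fun t => (q.[t] * w t)%:C * (resolvent z t * resolvent z t))).
Proof.
move=> bz; have [_ [B HB]] := gauss_dominated_weight w1 w2 s1 s2 q.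
have dw := gauss_dominated_weight w1 w2 s1 s2 q.
set b := `|complex.Im z|; have b0 : 0 < b by rewrite normr_gt0.
pose K := 2 * (B * (2 * b^-1 * (b^-1 * b^-1))) * \int[@lebesgue_measure R]_t hgauss t.
apply: (@is_cderive_quad _ _ _ _ (b / 2) K); first by rewrite divr_gt0.
move=> h hb.
have bh : b / 2 <= `|complex.Im (z + h)|.
  have : `|complex.Im h| < b / 2 by rewrite -ltcR; exact: le_lt_trans (Im_le_norm _) hb.
  rewrite complex_ImD => H; have := ler_normB (complex.Im z + complex.Im h) (complex.Im h).
  by rewrite addrK -/b; lra.
have bzh : complex.Im (z + h) != 0.
  by rewrite -normr_gt0 (lt_le_trans _ bh)// divr_gt0.
have d1 := cgauss_dominated_resolvent dw bz.
have d2 := cgauss_dominated_resolvent dw bzh.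
have d3 := cgauss_dominated_resolvent2 dw bz bz.
pose T t := (q.[t] * w t)%:C * (resolvent (z + h) t * (resolvent z t * resolvent z t)).
have rz t := resolvent_le t bz.
have rT t : `|resolvent (z + h) t * (resolvent z t * resolvent z t)|
    <= (2 * b^-1 * (b^-1 * b^-1))%:C.
  apply: norm_mul_le; last by apply: norm_mul_le; exact: rz.
  apply: (le_trans (resolvent_le t bzh)); rewrite lecR.
  rewrite -[2 / b]invf_div lef_pV2 ?posrE ?divr_gt0//.
  by rewrite (lt_le_trans _ bh)// divr_gt0.
have dT : cgauss_dominated T.
  apply: (cgauss_dominatedM dw _ rT).
  by do 2?apply: RC_continuousM; exact: RC_continuous_resolvent.
pose I2 := cintegral (fun t => (q.[t] * w t)%:C * (resolvent z t * resolvent z t)).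
have E : cauchy q (z + h) = cauchy q z + (h * I2 + h ^+ 2 * cintegral T).
  have Z2 := cgauss_dominatedZ h d3; have Z3 := cgauss_dominatedZ (h ^+ 2) dT.
  rewrite !cauchy_intE /I2 -!cintegralZ// -!cintegralD//; last exact: cgauss_dominatedD.
  apply: eq_cintegral => t; rewrite /T /resolvent.
  have := resolvent_den_neq0 t bz; have := resolvent_den_neq0 t bzh.
  rewrite (_ : t%:C - (z + h) = t%:C - z - h); last by ring.
  move: (q.[t] * w t)%:C (t%:C - z) => u v D1 D2; field.
  by rewrite D1 D2.
have -> : cauchy q (z + h) - cauchy q z - h * I2 = h ^+ 2 * cintegral T by rewrite E; ring.
rewrite normrM normrX mulrC ler_wpM2r ?exprn_ge0//.
apply: cintegral_le => // t.
rewrite mulrAC; apply: norm_mul_le => //; by rewrite norm_real_complex lecR.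
Qed.

Definition pearson q : {poly R} := q^`() - 2 *: 'X * q.

(** Differentiating the kernel produces 1 / (t - z)^2. Integrating the t-derivative of q(t) e^(-t^2)
    / (t - z) against the step function trades this double pole for the Cauchy transform of
    [pearson q]; the boundary terms at the jumps are the two fractions. *)
Lemma cauchy_int_cderive q z : complex.Im z != 0 ->
  is_cderive (cauchy q) z (cauchy (pearson q) z
    + (jump1 * q.[s1])%:C / (s1%:C - z) + (jump2 * q.[s2])%:C / (s2%:C - z)).
Proof.
move=> bz; have := cauchy_int_derivable q bz; congr is_cderive.
pose g t := q.[t] * expR (- t ^+ 2); pose dg t := (pearson q).[t] * expR (- t ^+ 2).
pose F t := (g t)%:C * resolvent z t.
pose f t := (dg t)%:C * resolvent z t + (- g t)%:C * (resolvent z t * resolvent z t).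
have Gg := gauss_dominated_poly q; have Gdg := gauss_dominated_poly (pearson q).
have DF t : is_derive_RC F t (f t).
  have := is_derive_RC_mul (is_derive_RC_real (is_derive_gauss_poly q t)) (is_derive_RC_resolvent t bz).
  by congr is_derive_RC; rewrite /f /g mulrN -expr2 rmorphN mulNr.
have gF : cgauss_dominated F by exact: cgauss_dominated_resolvent.
have gf1 : cgauss_dominated (fun t => (dg t)%:C * resolvent z t) by exact: cgauss_dominated_resolvent.
have gf2 : cgauss_dominated (fun t => (- g t)%:C * (resolvent z t * resolvent z t)).
  by apply: cgauss_dominated_resolvent2 => //; exact: gauss_dominatedN.
have gf : cgauss_dominated f by exact: cgauss_dominatedD.
have cf : RC_continuous f.
  have cr := RC_continuous_resolvent bz.
  apply: RC_continuousD; apply: RC_continuousM => //.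
  - by apply: RC_continuous_real; exact: continuous_gauss_poly.
  - apply: RC_continuous_real => t; apply: cvgN; exact: continuous_gauss_poly.
  - exact: RC_continuousM.
have I : cintegral (fun t => f t * (step w1 w2 s1 s2 t)%:C)
    = (1 - w1)%:C * F s1 + (w1 - w2)%:C * F s2.
  have [gF1 gF2] := gF; have [gf1' gf2'] := gf; have [cf1 cf2] := cf.
  apply: complex_eqP; rewrite !(complex_ReD, complex_ImD, complex_ReM, complex_ImM) /=.
    under eq_fun do rewrite complex_ReM /= mulr0 subr0.
    by rewrite (Rintegral_step_FTC w1 w2 s12 gf1' gF1 cf1 (fun t => (DF t).1)) /F !complex_ReM /=; ring.
  under eq_fun do rewrite complex_ImM /= mulr0 add0r.
  by rewrite (Rintegral_step_FTC w1 w2 s12 gf2' gF2 cf2 (fun t => (DF t).2)) /F !complex_ImM /=; ring.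
have E : cintegral (fun t => f t * (step w1 w2 s1 s2 t)%:C) = cauchy (pearson q) z
    + - 1 * cintegral (fun t => (q.[t] * w t)%:C * (resolvent z t * resolvent z t)).
  have dw := gauss_dominated_weight w1 w2 s1 s2 q.
  rewrite cauchy_intE -cintegralZ; last exact: cgauss_dominated_resolvent2.
  rewrite -cintegralD; last 2 first.
  - by apply: cgauss_dominated_resolvent => //; exact: gauss_dominated_weight.
  - by apply: cgauss_dominatedZ; exact: cgauss_dominated_resolvent2.
  apply: eq_cintegral => t; rewrite !weightE /f /g /dg !rmorphM rmorphN/= !rmorphM/=; ring.
rewrite I in E; move: E; rewrite mulN1r => /eqP; rewrite -subr_eq => /eqP.
rewrite /F /g /jump1 /jump2 /resolvent.
move: (cauchy _ _) (cintegral _) => A B E; rewrite -[LHS]opprK -E.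
rewrite !(rmorphM, rmorphB, rmorph1)/=; ring.
Qed.

End CauchyTransform.

(** * Rational functions off the real axis *)

Section ComplexAlgebra.
Context {R : realType}.
Notation C := (R[i]).
Implicit Types (z : C) (P Q : {poly C}).

(** Identities with Cauchy transforms hold off the real axis only; enough points of the imaginary
    axis still determine a polynomial. *)
Lemma poly_eq0_nonreal P : (forall z, complex.Im z != 0 -> P.[z] = 0) -> P = 0.
Proof.
move=> P0; pose r := [seq 0 +i* (k.+1%:R : R) | k <- iota 0 (size P)].
apply: (@roots_geq_poly_eq0 _ P r); last by rewrite size_map size_iota.
  by apply/allP => z /mapP[k _ ->]; apply/eqP/P0; rewrite /= pnatr_eq0.
rewrite map_inj_uniq ?iota_uniq// => i j [/eqP].
by rewrite eqr_nat => /eqP[].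
Qed.

Lemma horner_div_sub P (a : C) : exists Q, forall z, z != a ->
  P.[z] / (z - a) = Q.[z] + P.[a] / (z - a).
Proof.
have /factor_theorem[Q QE] : root (P - P.[a]%:P) a by rewrite /root !hornerE subrr.
exists Q => z za; have /(congr1 (fun p => p.[z])) := QE.
rewrite hornerM hornerD hornerN hornerC hornerXsubC => /eqP; rewrite subr_eq => /eqP ->.
by rewrite mulrDl mulfK ?subr_eq0.
Qed.

Lemma mx2_mul (a b c d a' b' c' d' : C) :
  mx2 a b c d *m mx2 a' b' c' d' =
  mx2 (a * a' + b * c') (a * b' + b * d') (c * a' + d * c') (c * b' + d * d').
Proof.
apply/matrixP => i j; rewrite !mxE big_ord_recl big_ord1 !mxE/=.
by case: (i == 0); case: (j == 0).
Qed.

Lemma mx2E (M : 'M[C]_2) : M = mx2 (M 0 0) (M 0 1) (M 1 0) (M 1 1).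
Proof.
apply/matrixP => i j; rewrite !mxE.
by case: i => [[|[|i]]//= hi]; case: j => [[|[|j]]//= hj]; congr (M _ _); apply: val_inj.
Qed.

Lemma mx2_inv (a b c d : C) : a * d - b * c = 1 ->
  invmx (mx2 a b c d) = mx2 d (- b) (- c) a.
Proof.
move=> D; have M1 : mx2 d (- b) (- c) a *m mx2 a b c d = 1%:M.
  rewrite mx2_mul [RHS]mx2E !mxE/=; congr mx2; rewrite ?mulr1n ?mulr0n -?D; ring.
have [u _] : mx2 a b c d \in unitmx /\ True by split => //; have [] := mulmx1_unit M1.
by rewrite -[RHS](mulmxK u) M1 mul1mx.
Qed.

(** Clearing denominators gives a polynomial that vanishes off the real axis, hence everywhere; its
    values at -s and s are the differences of the residues times -2s and 2s. This pins down the
    matrices selected by [xget] in [residues]. *)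
Lemma residues_unique (Lf : C -> 'M[C]_2) (s : R) A B : s != 0 ->
  simple_poles_residues Lf s A -> simple_poles_residues Lf s B -> A = B.
Proof.
move=> s0 [P HP] [Q HQ].
have sC : s%:C + s%:C != 0 :> C.
  by rewrite -rmorphD -(rmorph0 (real_complex R)) (inj_eq (@complexI R)) -mulr2n mulrn_eq0.
have H i j : A.1 i j = B.1 i j /\ A.2 i j = B.2 i j.
  pose T : {poly C} := (P i j - Q i j) * (('X + s%:C%:P) * ('X - s%:C%:P))
    + (A.1 i j - B.1 i j) *: ('X - s%:C%:P) + (A.2 i j - B.2 i j) *: ('X + s%:C%:P).
  have T0 : T = 0.
    apply: poly_eq0_nonreal => z bz.
    have /matrixP/(_ i j) := HP z bz; have /matrixP/(_ i j) := HQ z bz.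
    rewrite !mxE => -> E.
    have n1 : z + s%:C != 0.
      by apply: contra bz => /eqP/(congr1 (@complex.Im R)); rewrite complex_ImD /= addr0 => ->.
    have n2 : z - s%:C != 0.
      by apply: contra bz => /eqP/(congr1 (@complex.Im R)); rewrite complex_ImD complex_ImN /= subr0 => ->.
    have E' : (P i j).[z] = (Q i j).[z] + (z + s%:C)^-1 * B.1 i j + (z - s%:C)^-1 * B.2 i j
       - (z + s%:C)^-1 * A.1 i j - (z - s%:C)^-1 * A.2 i j by rewrite E; ring.
    rewrite /T !(hornerD, hornerM, hornerN, hornerZ, hornerX, hornerC) E'.
    move: (z + s%:C) (z - s%:C) n1 n2 => u v n1 n2; field.
    by rewrite n1 n2.
  have := congr1 (fun p => p.[s%:C]) T0; have := congr1 (fun p => p.[- s%:C]) T0.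
  rewrite /T !(hornerD, hornerM, hornerN, hornerZ, hornerX, hornerC) !subrr !addNr.
  rewrite !(mul0r, mulr0, add0r, addr0) => /eqP; rewrite mulf_eq0 => /orP[/eqP E1|]; last first.
    by rewrite -opprD oppr_eq0 (negPf sC).
  move=> /eqP; rewrite mulf_eq0 => /orP[/eqP E2|]; last by rewrite (negPf sC).
  by split; apply/eqP; rewrite -subr_eq0 ?E1 ?E2.
by case: A B H {HP HQ} => [A1 A2] [B1 B2] H; congr pair; apply/matrixP => i j; have [] := H i j.
Qed.

(** Subtracting the two expansions at z = iT and multiplying by z bounds |c1 - d1| by |c2 - d2| / T
    + (K + K') / T^2, which is impossible for large T unless c1 = d1. *)
Lemma expands_unique (f : C -> C) (c0 c1 c2 d1 d2 : C) :
  expands_at_infty f c0 c1 c2 -> expands_at_infty f c0 d1 d2 -> c1 = d1.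
Proof.
move=> [K [M H]] [K' [M' H']].
pose e := c2 - d2; pose d := c1 - d1.
have /complex_realP[k kE] : `|d| \is Num.real by exact: normr_real.
have /complex_realP[l lE] : `|e| \is Num.real by exact: normr_real.
apply/eqP; rewrite -subr_eq0 -normr_eq0 -/d kE -(rmorph0 (real_complex R)) (inj_eq (@complexI R)).
have k0 : 0 <= k by rewrite -ler0c -kE.
have l0 : 0 <= l by rewrite -ler0c -lE.
rewrite eq_le k0 andbT leNgt; apply/negP => kp.
(* [T] exceeds 1, both thresholds and N / k, so that the bound N / T falls below k = |c1 - d1|. *)
pose N := l + `|K| + `|K'|.
pose T := 1 + `|M| + `|M'| + N / k.
have N0 : 0 <= N by rewrite /N !addr_ge0.
have Nk : 0 <= N / k by rewrite divr_ge0.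
have T1 : 1 <= T by rewrite /T -!addrA lerDl !addr_ge0.
have T0 : 0 < T by rewrite (lt_le_trans _ T1).
have TM : M < T by rewrite /T; have := ler_norm M; have := normr_ge0 M'; lra.
have TM' : M' < T by rewrite /T; have := ler_norm M'; have := normr_ge0 M; lra.
pose z : C := 0 +i* T.
have zT : `|z| = T%:C by rewrite normc_def/= expr0n add0r sqrtr_sqr ger0_norm// ltW.
have bz : complex.Im z != 0 by rewrite /= gt_eqF.
have z0 : z != 0 by rewrite -normr_eq0 zT -(rmorph0 (real_complex R)) (inj_eq (@complexI R)) gt_eqF.
have h1 := H z bz; have h2 := H' z bz; rewrite zT !ltcR in h1 h2.
have {h1} h1 := h1 TM; have {h2} h2 := h2 TM'.
have E : `|d / z + e / z ^+ 2| <= (K%:C + K'%:C) / T%:C ^+ 3.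
  rewrite [leRHS]mulrDl; apply: (le_trans _ (lerD h1 h2)); rewrite -[X in _ <= X + _]normrN.
  apply: (le_trans _ (ler_normD _ _)); rewrite le_eqVlt; apply/orP; left; apply/eqP; congr `|_|.
  rewrite /d /e; ring.
have : `|d| <= `|e| / T%:C + (K%:C + K'%:C) / T%:C ^+ 2.
  have -> : d = - (e / z) + (d / z + e / z ^+ 2) * z by field.
  apply: (le_trans (ler_normD _ _)); rewrite normrN normrM normfV zT lerD2l.
  rewrite normrM zT; apply: (@le_trans _ _ ((K%:C + K'%:C) / T%:C ^+ 3 * T%:C)).
    by rewrite ler_wpM2r// ler0c ltW.
  have Tn0 : T%:C != 0 by rewrite -(rmorph0 (real_complex R)) (inj_eq (@complexI R)) gt_eqF.
  by rewrite le_eqVlt; apply/orP; left; apply/eqP; field.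
rewrite kE lE -rmorphD -rmorphXn -!fmorphV -!rmorphM -rmorphD lecR.
apply/negP; rewrite -ltNge.
have A1 : (K + K') / T ^+ 2 <= (`|K| + `|K'|) / T.
  apply: (@le_trans _ _ ((`|K| + `|K'|) / T ^+ 2)).
    by rewrite ler_wpM2r ?invr_ge0 ?sqr_ge0// lerD// ler_norm.
  rewrite ler_wpM2l ?addr_ge0// lef_pV2 ?posrE ?exprn_gt0//.
  by rewrite expr2 ler_peMl// ltW.
have A2 : N / T < k.
  rewrite ltr_pdivrMr// -ltr_pdivrMl// mulrC /T.
  have := normr_ge0 M; have := normr_ge0 M'; lra.
apply: le_lt_trans A2; rewrite /N -addrA mulrDl; lra.
Qed.

Lemma expands_exact (f : C -> C) (c0 c1 c2 : C) :
  (forall z, z != 0 -> f z = c0 + c1 / z + c2 / z ^+ 2) -> expands_at_infty f c0 c1 c2.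
Proof.
move=> fE; exists 0, 0 => z bz _; rewrite mul0r fE ?subrr ?normr0//.
by apply: contra bz => /eqP ->.
Qed.

(** The quotient has no constant term, and its 1/z coefficient is the top one that the size bound
    allows. Passing from Q to [Q * 'X + c] and from n to n + 1 keeps the quotient up to c /
    z^(n+1). *)
Lemma expands_poly n Q : (size Q <= n)%N ->
  exists c2, expands_at_infty (fun z => Q.[z] / z ^+ n) 0 (Q`_n.-1) c2.
Proof.
have E0 m : exists c2, expands_at_infty (fun z => (0 : {poly C}).[z] / z ^+ m) 0 ((0 : {poly C})`_m.-1) c2.
  by exists 0; apply: expands_exact => z z0; rewrite horner0 coef0 !mul0r !addr0.
elim/poly_ind: Q n => [|Q c IH] n; first by [].
case: n => [|n]; first by rewrite leqn0 size_poly_eq0 => /eqP ->.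
move=> sQ; have {}sQ : (size Q <= n)%N.
  by move: sQ; rewrite size_MXaddC; case: ifP => [/andP[/eqP -> _]|_]; rewrite ?size_poly0.
rewrite coefD coefMX coefC /=.
have fE z : z != 0 -> (Q * 'X + c%:P).[z] / z ^+ n.+1 = Q.[z] / z ^+ n + c / z ^+ n.+1.
  by move=> z0; rewrite hornerMXaddC mulrDl exprS; field; rewrite z0 expf_neq0.
(* The added term is the 1/z coefficient itself for exponent 1, joins the 1/z^2 coefficient for
   exponent 2, and goes into the error from exponent 3 on, where [Num.max M 1] ensures |z| > 1. *)
case: n sQ fE => [|n] sQ fE.
  move: sQ; rewrite leqn0 size_poly_eq0 => /eqP Q0.
  exists 0; apply: expands_exact => z z0; rewrite fE// Q0 horner0 !mul0r !add0r addr0.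
  by rewrite expr1.
have [c2 [K [M H]]] := IH n.+1 sQ; rewrite addr0.
case: n sQ fE H => [|n] sQ fE H.
  exists (c2 + c), K, M => z bz Mz; apply: le_trans (H z bz Mz).
  have z0 : z != 0 by apply: contra bz => /eqP ->.
  rewrite fE// le_eqVlt; apply/orP; left; apply/eqP; congr `|_|; ring.
have /complex_realP[k kE] : `|c| \is Num.real by exact: normr_real.
exists c2, (K + k), (Num.max M 1) => z bz Mz.
have z0 : z != 0 by apply: contra bz => /eqP ->.
have [z1 zM] : 1 < `|z| /\ M%:C < `|z|.
  split; apply: le_lt_trans Mz; last by rewrite lecR le_max lexx.
  by rewrite -(rmorph1 (real_complex R)) lecR le_max lexx orbT.
rewrite fE//.
have -> : forall a b u v w : C, a + b - (u + v + w) = (a - (u + v + w)) + b by move=> *; ring.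
apply: (le_trans (ler_normD _ _)); rewrite rmorphD [leRHS]mulrDl; apply: lerD; first exact: H.
rewrite normrM normfV normrX kE ler_wpM2l//; first by rewrite -kE.
rewrite lef_pV2 ?posrE ?exprn_gt0 ?normr_gt0//.
by rewrite ler_eXn2l.
Qed.

End ComplexAlgebra.

(** * Polynomial and rational combinations of Cauchy transforms *)

Section CauchyAlgebra.
Context {R : realType}.
Notation C := (R[i]).
Variables (w1 w2 s1 s2 : R).
Hypothesis s12 : s1 < s2.
Notation w := (weight s1 s2 w1 w2).
Notation L := (wfun w1 w2 s1 s2).
Notation cauchy := (cauchy_int w).
Implicit Types (q r a b : {poly R}) (z : C).

Lemma cevalD q r z : ceval (q + r) z = ceval q z + ceval r z.
Proof. by rewrite /ceval rmorphD hornerD. Qed.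

Lemma cevalN q z : ceval (- q) z = - ceval q z.
Proof. by rewrite /ceval rmorphN hornerN. Qed.

Lemma cevalM q r z : ceval (q * r) z = ceval q z * ceval r z.
Proof. by rewrite /ceval rmorphM hornerM. Qed.

Lemma cevalZ (c : R) q z : ceval (c *: q) z = c%:C * ceval q z.
Proof. by rewrite /ceval map_polyZ hornerZ. Qed.

Lemma cevalX z : ceval 'X z = z.
Proof. by rewrite /ceval map_polyX hornerX. Qed.

Lemma ceval_real q (t : R) : ceval q t%:C = q.[t]%:C.
Proof. by rewrite /ceval horner_map. Qed.

Lemma cauchy_intD q r z : complex.Im z != 0 -> cauchy (q + r) z = cauchy q z + cauchy r z.
Proof. by move=> bz; have := cauchy_int_linear w1 w2 s1 s2 1 q r bz; rewrite scale1r mul1r. Qed.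

Lemma cauchy_int0 z : complex.Im z != 0 -> cauchy 0 z = 0.
Proof. by move=> bz; have := cauchy_intD 0 0 bz; rewrite addr0 => /eqP; rewrite addrC -subr_eq subrr => /eqP. Qed.

Lemma cauchy_intZ (c : R) q z : complex.Im z != 0 -> cauchy (c *: q) z = c%:C * cauchy q z.
Proof.
by move=> bz; have := cauchy_int_linear w1 w2 s1 s2 c q 0 bz; rewrite addr0 cauchy_int0// addr0.
Qed.

(** The quotient (q(t) - q(z)) / (t - z) is a polynomial, so the only transcendental part is the
    transform of 1, with factor q(z). It cancels in every antisymmetric combination. *)
Lemma cauchy_int_poly q : exists P : {poly C}, forall z, complex.Im z != 0 ->
  cauchy q z = ceval q z * cauchy 1 z + P.[z].
Proof.
elim/poly_ind: q => [|q c [P IH]].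
  by exists 0 => z bz; rewrite cauchy_int0// /ceval rmorph0 horner0 mul0r add0r.
exists ('X * P + (L q)%:C%:P) => z bz.
rewrite -[c%:P]mulr1 mul_polyC [q * 'X]mulrC cauchy_intD// cauchy_intZ// cauchy_int_mulX// IH//.
rewrite cevalD cevalM cevalX cevalZ !(hornerD, hornerM, hornerX, hornerC).
have -> : ceval 1 z = 1 by rewrite /ceval rmorph1 hornerC.
ring.
Qed.

Lemma cauchy_int_bracket q r : exists P : {poly C}, forall z, complex.Im z != 0 ->
  ceval q z * cauchy r z - ceval r z * cauchy q z = P.[z].
Proof.
have [P HP] := cauchy_int_poly q; have [Q HQ] := cauchy_int_poly r.
exists (map_poly (real_complex R) q * Q - map_poly (real_complex R) r * P) => z bz.
by rewrite HP// HQ// hornerD hornerN !hornerM -!/(ceval _ _); ring.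
Qed.

(* e^(z^2/2) dcauchy a z is the derivative of e^(z^2/2) times the Cauchy transform
   of a: since a' - 2ta + za = (a' - ta) - (t - z)a, the integration by parts leaves
   the constant - L a besides the contributions of the two jumps. *)
Definition dcauchy a z : C := cauchy (a^`() - 'X * a) z - (L a)%:C
  + (jump1 w1 s1 * a.[s1])%:C / (s1%:C - z) + (jump2 w1 w2 s2 * a.[s2])%:C / (s2%:C - z).

(** The determinant of the derivatives of the column functions attached to a with the functions
    attached to b, after the factors e^(z^2/2) and e^(-z^2/2) have cancelled. All entries of Phi_z
    Phi^(-1) are constant multiples of such brackets. *)
Definition bracket a b z : C := dcauchy a z * ceval b z - ceval (a^`() - 'X * a) z * cauchy b z.

(* (f(t) g(z) - f(z) g(t)) / (t - z) is a polynomial, so only the jumps contribute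
   to the principal part. *)
Lemma bracketE a b : exists P : {poly C}, forall z, complex.Im z != 0 ->
  bracket a b z = P.[z] - (jump1 w1 s1 * a.[s1] * b.[s1])%:C / (z - s1%:C)
    - (jump2 w1 w2 s2 * a.[s2] * b.[s2])%:C / (z - s2%:C).
Proof.
have [P HP] := cauchy_int_bracket (a^`() - 'X * a) b.
have [Q1 HQ1] := horner_div_sub (map_poly (real_complex R) b) s1%:C.
have [Q2 HQ2] := horner_div_sub (map_poly (real_complex R) b) s2%:C.
pose j1 := (jump1 w1 s1 * a.[s1])%:C; pose j2 := (jump2 w1 w2 s2 * a.[s2])%:C.
exists (- P - (L a)%:C *: map_poly (real_complex R) b - j1 *: Q1 - j2 *: Q2) => z bz.
have nz (t : R) : z != t%:C by apply: contra bz => /eqP ->.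
have := HP z bz; have := HQ1 z (nz s1); have := HQ2 z (nz s2).
rewrite -!/(ceval _ _) !ceval_real /bracket /dcauchy => E2 E1 E0.
rewrite !(hornerD, hornerN, hornerZ) -!/(ceval _ _) -E0.
have -> : Q1.[z] = ceval b z / (z - s1%:C) - (b.[s1])%:C / (z - s1%:C) by rewrite E1 addrK.
have -> : Q2.[z] = ceval b z / (z - s2%:C) - (b.[s2])%:C / (z - s2%:C) by rewrite E2 addrK.
rewrite -[s1%:C - z]opprB -[s2%:C - z]opprB !invrN /j1 /j2 !rmorphM/=; ring.
Qed.

Lemma is_cderive_shift (f : C -> C) (x : R) z d : is_cderive f (z + x%:C) d ->
  is_cderive (fun v => f (v + x%:C)) z d.
Proof.
move=> df; have := is_cderive_comp (is_cderiveD (is_cderive_id z) (is_cderive_cst x%:C z)) df.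
by rewrite addr0 mulr1.
Qed.

Definition egauss (z : C) : C := cexp (- (z ^+ 2 / 2)).
Definition egaussV (z : C) : C := cexp (z ^+ 2 / 2).

Lemma egaussK z : egauss z * egaussV z = 1.
Proof. exact: cexpN. Qed.

Lemma is_cderive_sqr2 z : is_cderive (fun v => v ^+ 2 / 2) z z.
Proof.
have := is_cderiveM (is_cderiveM (is_cderive_id z) (is_cderive_id z)) (is_cderive_cst 2^-1 z).
rewrite mulr0 addr0 mul1r mulr1 (_ : (z + z) / 2 = z); last by field.
by congr is_cderive.
Qed.

Lemma is_cderive_egaussV z : is_cderive egaussV z (z * egaussV z).
Proof. by rewrite mulrC; exact: (is_cderive_comp (is_cderive_sqr2 z) (is_cderive_cexp _)). Qed.

Lemma is_cderive_egauss z : is_cderive egauss z (- z * egauss z).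
Proof.
rewrite mulrC; apply: is_cderive_comp (is_cderive_cexp _).
have := is_cderiveZ (-1) (is_cderive_sqr2 z); rewrite mulN1r; congr is_cderive.
by apply/funext => v; rewrite mulN1r.
Qed.

Lemma is_cderive_ceval q z : is_cderive (ceval q) z (ceval q^`() z).
Proof. by rewrite /ceval -deriv_map; exact: is_cderive_horner. Qed.

Lemma is_cderive_U q z :
  is_cderive (fun v => ceval q v * egauss v) z (ceval (q^`() - 'X * q) z * egauss z).
Proof.
have := is_cderiveM (is_cderive_ceval q z) (is_cderive_egauss z); congr is_cderive.
by rewrite cevalD cevalN cevalM cevalX; ring.
Qed.

Lemma is_cderive_V q z : complex.Im z != 0 ->
  is_cderive (fun v => cauchy q v * egaussV v) z
    (dcauchy q z * egaussV z).
Proof.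
move=> bz; have := is_cderiveM (cauchy_int_cderive w1 w2 s12 q bz) (is_cderive_egaussV z).
congr is_cderive; rewrite /dcauchy.
(* With this splitting the transform of ['X * q] yields -z times the transform of q, which cancels
   the factor z from differentiating [egaussV]. *)
have -> : pearson q = (q^`() - 'X * q) + (-1) *: ('X * q).
  rewrite /pearson scaleN1r -scalerAl scaler_nat mulr2n; ring.
rewrite cauchy_intD// cauchy_intZ// cauchy_int_mulX// rmorphN rmorph1; ring.
Qed.

End CauchyAlgebra.

(** The number of terms is a bound N, not the size, so that the sum can be differentiated when q
    depends on a parameter. *)
Lemma functional_expand (R : realFieldType) (M : {linear {poly R} -> R | *%R}) (q : {poly R}) N : (size q <= N)%N ->
  M q = \sum_(i < N) q`_i * M 'X^i.
Proof.
move=> sq; have {1}-> : q = \sum_(i < N) q`_i *: 'X^i.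
  rewrite -[LHS](coefK q) poly_def (big_ord_widen _ (fun i => q`_i *: 'X^i) sq).
  rewrite big_mkcond/=; apply: eq_bigr => i _; case: ltnP => // si.
  by rewrite nth_default// scale0r.
by rewrite linear_sum; apply: eq_bigr => i _; rewrite linearZ.
Qed.

Lemma deriv_horner_wide (R : realFieldType) (q : {poly R}) (x : R) N : (size q <= N)%N ->
  q^`().[x] = \sum_(i < N) q`_i * (i%:R * x ^+ i.-1).
Proof.
case: N => [|N] sq.
  by move: sq; rewrite leqn0 size_poly_eq0 big_ord0 => /eqP ->; rewrite deriv0 horner0.
have sq' : (size q^`() <= N)%N.
  apply/leq_sizeP => i Ni; rewrite coef_deriv nth_default ?mul0rn//.
  exact: leq_trans sq _.
rewrite (horner_coef_wide _ sq') big_ord_recl/= mul0r mulr0 add0r.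
by apply: eq_bigr => i _; rewrite coef_deriv /bump/= add1n mulrA mulr_natr.
Qed.

(** * Orthogonal polynomials and their deformation *)

Section OrthogonalPolynomials.
Context {R : realFieldType}.
Variables (L : {linear {poly R} -> R | *%R}) (p : nat -> {poly R}) (h : nat -> R).

Implicit Types (q : {poly R}) (m n : nat).

(** The weight is replaced by an abstract linear form, the only feature of the integrals that the
    algebra uses; [h n] stands for gamma_n^(-2). *)
Definition orthogonal_family : Prop :=
  [/\ forall n, p n \is monic, forall n, size (p n) = n.+1, forall n, 0 < h n
    & forall m n, L (p m * p n) = if m == n then h n else 0].

Hypothesis op : orthogonal_family.

Lemma op_lead n : (p n)`_n = 1.
Proof.
by have [/(_ n)/monicP + /(_ n) s _ _] := op; rewrite lead_coefE s.
Qed.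

Lemma op_reduce_size q n : (size q <= n.+1)%N -> (size (q - q`_n *: p n)%R <= n)%N.
Proof.
move=> sq; have [_ s _ _] := op; apply/leq_sizeP => j; rewrite leq_eqVlt.
case/orP => [/eqP <-|nj]; first by rewrite coefB coefZ op_lead mulr1 subrr.
by rewrite coefB coefZ [q`_j]nth_default ?(leq_trans sq)// [(p n)`_j]nth_default ?s// mulr0 subr0.
Qed.

Lemma op_orthogonal n q m : (size q <= n)%N -> (n <= m)%N -> L (q * p m) = 0.
Proof.
elim: n q => [|n IH] q.
  by rewrite leqn0 size_poly_eq0 => /eqP -> _; rewrite mul0r linear0.
move=> sq nm; have [_ _ _ o] := op.
have := IH _ (op_reduce_size sq) (ltnW nm).
rewrite mulrBl linearB/= => /eqP; rewrite subr_eq0 => /eqP ->.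
by rewrite -scalerAl linearZ/= o ltn_eqF// mulr0.
Qed.

Lemma op_coef q n : (size q <= n.+1)%N -> L (q * p n) = q`_n * h n.
Proof.
move=> sq; have [_ _ _ o] := op.
have := op_orthogonal (op_reduce_size sq) (leqnn n).
rewrite mulrBl linearB/= => /eqP; rewrite subr_eq0 => /eqP ->.
by rewrite -scalerAl linearZ/= o eqxx.
Qed.

Lemma op_expand q n : (size q <= n)%N -> q = \sum_(i < n) (L (q * p i) / h i) *: p i.
Proof.
elim: n q => [|n IH] q.
  by rewrite leqn0 size_poly_eq0 big_ord0 => /eqP.
move=> sq; have [_ _ h0 o] := op; rewrite big_ord_recr/= op_coef// mulfK ?gt_eqF//.
apply/eqP; rewrite -subr_eq; apply/eqP.
rewrite {1}(IH _ (op_reduce_size sq)); apply: eq_bigr => i _; congr (_ / _ *: _).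
by rewrite mulrBl linearB/= -scalerAl linearZ/= o gtn_eqF ?mulr0 ?subr0// ltn_ord.
Qed.

Lemma op0 : p 0 = 1.
Proof.
have [_ s _ _] := op; rewrite (size1_polyC (p := p 0)) ?s//.
by rewrite op_lead.
Qed.

Variables (alpha beta : nat -> R).
Hypothesis rec : forall n, 'X * p n = p n.+1 + alpha n *: p n +
  (if n is m.+1 then beta n ^+ 2 *: p m else 0).

Lemma op_alpha n : L ('X * p n * p n) = alpha n * h n.
Proof.
have [_ _ _ o] := op; rewrite rec !mulrDl !linearD/= -!scalerAl linearZ/= !o gtn_eqF// eqxx add0r.
case: n => [|n]; first by rewrite mul0r linear0 addr0.
by rewrite -scalerAl linearZ/= o ltn_eqF// mulr0 addr0.
Qed.

Lemma op_mulX n : L ('X * p n * p n.+1) = h n.+1.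
Proof.
have [_ s _ _] := op; rewrite op_coef ?coefXM/= ?op_lead ?mul1r//.
by rewrite (leq_trans (size_polyMleq _ _))// size_polyX s.
Qed.

Lemma op_beta n : beta n.+1 ^+ 2 = h n.+1 / h n.
Proof.
have [_ _ h0 o] := op; rewrite -op_mulX mulrAC.
have -> : 'X * p n.+1 * p n = ('X * p n.+1) * p n by [].
rewrite rec !mulrDl !linearD/= -!scalerAl !linearZ/= !o eqxx.
rewrite (gtn_eqF (ltnSn n)) (gtn_eqF (leqW (ltnSn n))) mulr0 !add0r.
by rewrite mulfK ?gt_eqF.
Qed.

Lemma op_subleading n : (p n.+1)`_n = - \sum_(j < n.+1) alpha j.
Proof.
have E k : (p k.+1)`_k = ('X * p k)`_k - alpha k.
  have [_ s _ _] := op.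
  have /(congr1 (fun q : {poly R} => q`_k)) -> := rec k.
  rewrite !coefD coefZ op_lead mulr1.
  case: k => [|k]; first by rewrite coef0 addr0 addrK.
  by rewrite coefZ [(p k)`_k.+1]nth_default ?s// mulr0 addr0 addrK.
elim: n => [|n IH]; first by rewrite E coefXM/= sub0r big_ord1.
by rewrite E coefXM/= IH [in RHS]big_ord_recr/= opprD.
Qed.

End OrthogonalPolynomials.

(** * Differentiability of families of orthogonal polynomials *)

Section PolynomialFamilies.
Context {R : realType}.
Variables (x0 : R) (L : R -> {linear {poly R} -> R | *%R}) (dL : {linear {poly R} -> R | *%R}).
Hypothesis DL : forall q, is_derive x0 1 (fun u => L u q) (dL q).
Implicit Types (P Q : R -> {poly R}) (dP dQ : {poly R}).

(** The local bound on sizes turns products, linear forms and evaluations into finite sums of fixed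
    length, so that coefficientwise derivatives suffice. *)
Definition poly_derive P dP : Prop :=
  (exists N, \forall u \near x0, (size (P u) <= N)%N) /\
  (forall i, is_derive x0 1 (fun u => (P u)`_i) dP`_i).

Lemma poly_derive_size P dP n : poly_derive P dP -> (\forall u \near x0, (size (P u) <= n)%N) ->
  (size dP <= n)%N.
Proof.
move=> [_ D] sP; apply/leq_sizeP => j nj.
have [_ <-] := D j; rewrite -[RHS](derive_cst (0 : R) x0 (1 : R)).
apply: near_eq_derive; near=> u.
by rewrite nth_default// (leq_trans _ nj)//; near: u.
Unshelve. all: by end_near. Qed.

Lemma poly_derive_cst q : poly_derive (fun=> q) 0.
Proof.
split; first by exists (size q); near=> u.
by move=> i; rewrite coef0; exact: is_derive_cst.
Unshelve. all: by end_near. Qed.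

Lemma poly_derive_sub P dP Q dQ : poly_derive P dP -> poly_derive Q dQ ->
  poly_derive (fun u => P u - Q u) (dP - dQ).
Proof.
move=> [[N sN] D] [[M sM] E]; split.
  exists (maxn N M); near=> u; rewrite (leq_trans (size_polyD _ _))// size_polyN geq_max !leq_max.
  by apply/andP; split; apply/orP; [left|right]; near: u.
move=> i; rewrite coefB; under eq_fun do rewrite coefB.
exact: is_derive_subf.
Unshelve. all: by end_near. Qed.

Lemma poly_derive_add P dP Q dQ : poly_derive P dP -> poly_derive Q dQ ->
  poly_derive (fun u => P u + Q u) (dP + dQ).
Proof.
move=> [[N sN] D] [[M sM] E]; split.
  exists (maxn N M); near=> u; rewrite (leq_trans (size_polyD _ _))// geq_max !leq_max.
  by apply/andP; split; apply/orP; [left|right]; near: u.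
move=> i; rewrite coefD; under eq_fun do rewrite coefD.
exact: is_derive_addf.
Unshelve. all: by end_near. Qed.

Lemma poly_derive_scale (c : R -> R) (dc : R) P dP : is_derive x0 1 c dc -> poly_derive P dP ->
  poly_derive (fun u => c u *: P u) (dc *: P x0 + c x0 *: dP).
Proof.
move=> Dc [[N sN] D]; split.
  by exists N; near=> u; rewrite (leq_trans (size_scale_leq _ _))//; near: u.
move=> i; rewrite coefD !coefZ; under eq_fun do rewrite coefZ.
exact: is_derive_mulf.
Unshelve. all: by end_near. Qed.

Lemma poly_derive_mul P dP Q dQ : poly_derive P dP -> poly_derive Q dQ ->
  poly_derive (fun u => P u * Q u) (dP * Q x0 + P x0 * dQ).
Proof.
move=> [[N sN] D] [[M sM] E]; split.
  exists (N + M)%N; near=> u; rewrite (leq_trans (size_polyMleq _ _))//.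
  apply: leq_trans (leq_pred _) _; apply: leq_add; by near: u.
move=> i; rewrite coefD !coefM -big_split/=; under eq_fun do rewrite coefM.
by apply: is_derive_sumf => j _; exact: is_derive_mulf.
Unshelve. all: by end_near. Qed.

Lemma poly_derive_sum n (P : 'I_n -> R -> {poly R}) (dP : 'I_n -> {poly R}) :
  (forall i, poly_derive (P i) (dP i)) ->
  poly_derive (fun u => \sum_(i < n) P i u) (\sum_(i < n) dP i).
Proof.
elim: n P dP => [|n IH] P dP D.
  rewrite big_ord0; have := poly_derive_cst 0; congr poly_derive.
  by apply/funext => u; rewrite big_ord0.
rewrite big_ord_recr/=; under eq_fun do rewrite big_ord_recr/=.
by apply: poly_derive_add => //; exact: IH.
Qed.

Lemma poly_derive_near P Q dP : (\forall u \near x0, P u = Q u) ->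
  poly_derive P dP -> poly_derive Q dP.
Proof.
move=> PQ [[N sN] D]; split.
  exists N; near=> u; rewrite -(near PQ u)//; by near: u.
move=> i; apply: (near_eq_is_derive _ (D i)).
by near=> u; rewrite (near PQ u).
Unshelve. all: by end_near. Qed.

Lemma poly_derive_functional P dP : poly_derive P dP ->
  is_derive x0 1 (fun u => L u (P u)) (L x0 dP + dL (P x0)).
Proof.
move=> D; have [[N sN] DP] := D; have sdP := poly_derive_size D sN.
rewrite (functional_expand _ sdP) (functional_expand _ (nbhs_singleton sN)) -big_split/=.
apply: (@near_eq_is_derive _ _ _ (fun u => \sum_(i < N) (P u)`_i * L u 'X^i)).
  by near=> u; rewrite -functional_expand//; near: u.
by apply: is_derive_sumf => i _; exact: is_derive_mulf.
Unshelve. all: by end_near. Qed.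

Lemma poly_derive_horner P dP (c : R -> R) (dc : R) : poly_derive P dP ->
  is_derive x0 1 c dc ->
  is_derive x0 1 (fun u => (P u).[c u]) (dP.[c x0] + (P x0)^`().[c x0] * dc).
Proof.
move=> D Dc; have [[N sN] DP] := D; have sdP := poly_derive_size D sN.
apply: (@near_eq_is_derive _ _ _ (fun u => \sum_(i < N) (P u)`_i * c u ^+ i)).
  by near=> u; rewrite (@horner_coef_wide _ N)//; near: u.
have -> : dP.[c x0] + (P x0)^`().[c x0] * dc =
    \sum_(i < N) (dP`_i * c x0 ^+ i + (P x0)`_i * (i%:R * c x0 ^+ i.-1 * dc)).
  rewrite big_split/= -horner_coef_wide//; congr (_ + _).
  rewrite (deriv_horner_wide _ (nbhs_singleton sN)) mulr_suml.
  by apply: eq_bigr => i _; rewrite -!mulrA.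
by apply: is_derive_sumf => i _; apply: is_derive_mulf => //; exact: is_derive_expf.
Unshelve. all: by end_near. Qed.

Variables (P : R -> nat -> {poly R}) (h : R -> nat -> R).
Hypothesis op : \forall u \near x0, orthogonal_family (L u) (P u) (h u).

(* Induction along the Gram-Schmidt formula, whose coefficients are values of L on
   polynomials of lower index. *)
Lemma op_family_derive j : exists dP, poly_derive (fun u => P u j) dP /\ (size dP <= j)%N.
Proof.
elim/ltn_ind: j => j IH.
have IH' i : exists d, (i < j)%N -> poly_derive (fun u => P u i) d /\ (size d <= i)%N.
  have [ij|ij] := ltnP i j; last by exists 0.
  by have [d Hd] := IH i ij; exists d.
have [dP HdP] := choice IH'.
have op0 := nbhs_singleton op.
pose Q (u : R) := 'X^j - \sum_(i < j) (L u ('X^j * P u i) / L u (P u i * P u i)) *: P u i.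
have QP : \forall u \near x0, Q u = P u j.
  near=> u; have o : orthogonal_family (L u) (P u) (h u) by near: u.
  have [mon sz h0 oo] := o.
  have s1 : (size ('X^j - P u j)%R <= j)%N.
    apply/leq_sizeP => k; rewrite leq_eqVlt coefB coefXn => /orP[/eqP <-|jk].
      by rewrite eqxx (op_lead o) subrr.
    by rewrite gtn_eqF// nth_default ?subr0// sz.
  rewrite /Q; apply/eqP; rewrite subr_eq addrC -subr_eq; apply/eqP.
  rewrite (op_expand o s1); apply: eq_bigr => i _.
  by rewrite mulrBl linearB/= !oo eqxx gtn_eqF ?ltn_ord// subr0.
have [d Hd] : exists d, poly_derive Q d.
  have Hi (i : 'I_j) : exists d, poly_derive (fun u => (L u ('X^j * P u i) / L u (P u i * P u i)) *: P u i) d.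
    have [Hd _] := HdP i (ltn_ord i).
    have D1 := poly_derive_functional (poly_derive_mul (poly_derive_cst 'X^j) Hd).
    have D2 := poly_derive_functional (poly_derive_mul Hd Hd).
    have n0 : L x0 (P x0 i * P x0 i) != 0 by have [_ _ h0 ->] := op0; rewrite eqxx gt_eqF.
    have D3 := is_derive_mulf D1 (is_derive_invf n0 D2).
    by eexists; exact: (poly_derive_scale D3 Hd).
  have [d Hd] := choice Hi.
  by eexists; exact: (poly_derive_sub (poly_derive_cst 'X^j) (poly_derive_sum Hd)).
have HP := poly_derive_near QP Hd.
exists d; split => //.
(* From index j on the coefficients do not depend on u: the one of index j is 1 by monicity, the
   others are 0. *)
apply/leq_sizeP => k jk; have [_ Dk] := HP; have [_ <-] := Dk k.
rewrite -[RHS](derive_cst ((P x0 j)`_k : R) x0 (1 : R)).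
apply: near_eq_derive; near=> u.
have o : orthogonal_family (L u) (P u) (h u) by near: u.
move: jk; rewrite leq_eqVlt => /orP[/eqP <-|jk].
  by rewrite (op_lead o) (op_lead op0).
have [_ s _ _] := o; have [_ s0 _ _] := op0.
by rewrite !nth_default ?s ?s0.
Unshelve. all: by end_near. Qed.

(** The motion of P_j contributes nothing, since its derivative has lower degree and is orthogonal
    to P_j; only the motion of the functional remains. *)
Lemma op_norm_derive j : is_derive x0 1 (fun u => h u j) (dL (P x0 j * P x0 j)).
Proof.
have op0 := nbhs_singleton op; have [dP [HdP sdP]] := op_family_derive j.
have := poly_derive_functional (poly_derive_mul HdP HdP).
rewrite linearD/= [P x0 j * dP]mulrC (op_orthogonal op0 sdP (leqnn j)) !add0r.
apply: near_eq_is_derive; near=> u.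
have [_ _ _ ->] : orthogonal_family (L u) (P u) (h u) by near: u.
by rewrite eqxx.
Unshelve. all: by end_near. Qed.

End PolynomialFamilies.

(** * The matrix Phi *)

Section Mx2.
Context {R : realType}.
Notation C := (R[i]).

Lemma mx2D (a b c d a' b' c' d' : C) :
  mx2 a b c d + mx2 a' b' c' d' = mx2 (a + a') (b + b') (c + c') (d + d').
Proof. by rewrite [LHS]mx2E !mxE. Qed.

Lemma mx2Z (k a b c d : C) : k *: mx2 a b c d = mx2 (k * a) (k * b) (k * c) (k * d).
Proof. by rewrite [LHS]mx2E !mxE. Qed.

Lemma map_mx2 (T : Type) (f : T -> C) (a b c d : T) :
  map_mx f (\matrix_(i < 2, j < 2) (if i == 0 then if j == 0 then a else b
    else if j == 0 then c else d)) = mx2 (f a) (f b) (f c) (f d).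
Proof. by rewrite [LHS]mx2E !mxE. Qed.

End Mx2.

Lemma orthogonal_system_family (R : realType) (w1 w2 t1 t2 : R) (p : nat -> {poly R})
    (gamma alpha beta : nat -> R) :
  orthogonal_system (weight t1 t2 w1 w2) p gamma alpha beta ->
  orthogonal_family (wfun w1 w2 t1 t2 : {linear {poly R} -> R | *%R}) p (fun n => gamma n ^- 2).
Proof.
move=> [H1 H2 H3 _]; split.
- by move=> k; have [] := H1 k.
- by move=> k; have [] := H1 k.
- by move=> k; rewrite invr_gt0 exprn_gt0.
move=> i j; rewrite -H3 /wfun; apply: eq_Rintegral => t _.
by rewrite hornerM.
Qed.

Section PhiMatrix.
Context {R : realType}.
Notation C := (R[i]).
Variables (w1 w2 x s : R) (p : nat -> {poly R}) (gamma alpha beta : nat -> R) (n : nat).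
Hypothesis s0 : 0 < s.
Notation s1 := (x - s).
Notation s2 := (x + s).
Notation w := (weight s1 s2 w1 w2).
Notation L := (wfun w1 w2 s1 s2).
Notation cauchy := (cauchy_int w).
Hypothesis sys : orthogonal_system w p gamma alpha beta.
Hypothesis n0 : (0 < n)%N.

Lemma shift_lt : s1 < s2. Proof. by rewrite ltrD2l gtrN. Qed.

Let system_family := orthogonal_system_family sys.

(* Inserting the three-term recurrence, the expression of index k + 1 is beta_(k+1)^2
   times that of index k. *)
Lemma cauchy_wronskian k (z : C) : complex.Im z != 0 ->
  ceval (p k) z * cauchy (p k.+1) z - ceval (p k.+1) z * cauchy (p k) z = (gamma k ^- 2)%:C.
Proof.
move=> bz; have [_ _ _ rec] := sys; have op := system_family.
have [_ _ _ oo] := op; have p0 := op0 op.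
elim: k => [|k IH].
  have -> : p 1 = 'X * p 0 + (- alpha 0) *: p 0.
    by rewrite rec addr0 scaleNr addrK.
  rewrite cauchy_intD// cauchy_intZ// cauchy_int_mulX// cevalD cevalM cevalX cevalZ.
  have -> : (L (p 0))%:C = (gamma 0 ^- 2)%:C by have /= := oo 0%N 0%N; rewrite p0 mulr1 => ->.
  have -> : ceval (p 0) z = 1 by rewrite p0 /ceval rmorph1 hornerC.
  ring.
have -> : p k.+2 = ('X * p k.+1 + (- alpha k.+1) *: p k.+1) + (- beta k.+1 ^+ 2) *: p k.
  by rewrite rec !scaleNr; ring.
rewrite !(cauchy_intD, cauchy_intZ)// cauchy_int_mulX// !(cevalD, cevalZ) cevalM cevalX.
have -> : L (p k.+1) = 0 by have /= := oo k.+1 0%N; rewrite p0 mulr1.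
have hE : gamma k.+1 ^- 2 = beta k.+1 ^+ 2 * gamma k ^- 2.
  have [_ _ h0 _] := op; rewrite (op_beta op rec) divfK// gt_eqF//; exact: h0.
rewrite [in RHS]hE [in RHS]rmorphM/= -IH !rmorphN rmorph0; ring.
Qed.

Notation g := (gamma n.-1 ^+ 2).
Notation q := (p n).
Notation r := (p n.-1).
Notation kappa := (two_pi_i R).

Definition cexp_half : C := cexp (x ^+ 2 / 2)%:C.
Definition cexp_halfV : C := cexp (- (x ^+ 2 / 2)%:C).

Lemma cexp_halfK : cexp_halfV * cexp_half = 1. Proof. exact: cexpN. Qed.

Lemma kappa_neq0 : kappa != 0.
Proof.
apply/eqP => /(congr1 (@complex.Im R))/= /eqP; rewrite mulf_eq0 pnatr_eq0/=.
by rewrite gt_eqF// pi_gt0.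
Qed.

Lemma g_neq0 : g != 0.
Proof. by have [_ gam _ _] := sys; rewrite expf_neq0// gt_eqF. Qed.

(** Conjugation by sigma1 swaps both rows and columns, which puts the Cauchy transforms in the first
    column, next to e^((z+x)^2/2). *)
Lemma PhimxE z : Phimx w p gamma n x z = mx2
  (cexp_halfV * (- g%:C * cauchy r (z + x%:C)) * egaussV (z + x%:C))
  (cexp_halfV * (- kappa * g%:C * ceval r (z + x%:C)) * egauss (z + x%:C))
  (cexp_half * (kappa^-1 * cauchy q (z + x%:C)) * egaussV (z + x%:C))
  (cexp_half * ceval q (z + x%:C) * egauss (z + x%:C)).
Proof.
rewrite /Phimx /sigma1 /exp_sigma3 /Ymx !mx2_mul opprK -/cexp_half -/cexp_halfV -/(egauss _) -/(egaussV _).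
congr mx2; ring.
Qed.

(** The exponentials cancel and the Wronskian of index n - 1 is gamma_(n-1)^(-2), compensated by the
    factor gamma_(n-1)^2. With determinant 1 the inverse of Phi is its adjugate, which is how the
    brackets arise. *)
Lemma Phimx_det z : complex.Im z != 0 ->
  (cexp_halfV * (- g%:C * cauchy r (z + x%:C)) * egaussV (z + x%:C)) *
  (cexp_half * ceval q (z + x%:C) * egauss (z + x%:C)) -
  (cexp_halfV * (- kappa * g%:C * ceval r (z + x%:C)) * egauss (z + x%:C)) *
  (cexp_half * (kappa^-1 * cauchy q (z + x%:C)) * egaussV (z + x%:C)) = 1.
Proof.
move=> bz; have bz' : complex.Im (z + x%:C) != 0 by rewrite complex_ImD /= addr0.
have := cauchy_wronskian n.-1 bz'; rewrite prednK// => W.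
transitivity (cexp_halfV * cexp_half * (egauss (z + x%:C) * egaussV (z + x%:C)) * g%:C *
  (ceval r (z + x%:C) * cauchy q (z + x%:C) - ceval q (z + x%:C) * cauchy r (z + x%:C))).
  have := kappa_neq0; move: (two_pi_i R) => k k0; field; exact: k0.
by rewrite W cexp_halfK egaussK !mul1r -rmorphM/= divff// g_neq0.
Qed.

Notation U a z := (ceval a z * egauss z).
Notation V a z := (cauchy a z * egaussV z).

Definition dU (a : {poly R}) z : C := ceval (a^`() - 'X * a) z * egauss z.
Definition dV (a : {poly R}) z : C := dcauchy w1 w2 s1 s2 a z * egaussV z.

Lemma dPhimxE z : complex.Im z != 0 -> dPhimx w p gamma n x z = mx2
  (- cexp_halfV * g%:C * dV r (z + x%:C)) (- cexp_halfV * kappa * g%:C * dU r (z + x%:C))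
  (cexp_half / kappa * dV q (z + x%:C)) (cexp_half * dU q (z + x%:C)).
Proof.
move=> bz; have bz' : complex.Im (z + x%:C) != 0 by rewrite complex_ImD /= addr0.
have DU a := is_cderive_shift (is_cderive_U a (z + x%:C)).
have DV a := is_cderive_shift (is_cderive_V w1 w2 shift_lt a bz').
have H i j f d : (forall v, Phimx w p gamma n x v i j = f v) -> is_cderive f z d ->
    dPhimx w p gamma n x z i j = d.
  move=> E D; rewrite mxE; apply: is_cderive_derive1; move: D; congr is_cderive.
  by apply/funext => v; rewrite E.
rewrite [LHS]mx2E; congr mx2.
- apply: (H _ _ _ _ _ (is_cderiveZ (- cexp_halfV * g%:C) (DV r))) => v.
  by rewrite PhimxE mxE/=; ring.
- apply: (H _ _ _ _ _ (is_cderiveZ (- cexp_halfV * kappa * g%:C) (DU r))) => v.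
  by rewrite PhimxE mxE/=; ring.
- apply: (H _ _ _ _ _ (is_cderiveZ (cexp_half / kappa) (DV q))) => v.
  by rewrite PhimxE mxE/=; ring.
- apply: (H _ _ _ _ _ (is_cderiveZ cexp_half (DU q))) => v.
  by rewrite PhimxE mxE/=; ring.
Qed.

Lemma dPhimx_mul_inv z : complex.Im z != 0 ->
  dPhimx w p gamma n x z *m invmx (Phimx w p gamma n x z) = mx2
   (- g%:C * bracket w1 w2 s1 s2 r q (z + x%:C))
   (- (cexp_halfV ^+ 2 * g%:C ^+ 2 * kappa) * bracket w1 w2 s1 s2 r r (z + x%:C))
   (cexp_half ^+ 2 / kappa * bracket w1 w2 s1 s2 q q (z + x%:C))
   (g%:C * bracket w1 w2 s1 s2 q r (z + x%:C)).
Proof.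
move=> bz; rewrite dPhimxE// PhimxE mx2_inv; last exact: Phimx_det.
rewrite mx2_mul /dV /dU /bracket.
have k0 := kappa_neq0; have xx := cexp_halfK; have ee := egaussK (z + x%:C).
move: (egauss _) (egaussV _) cexp_half cexp_halfV kappa k0 xx ee => e e' c c' k k0 cc ee.
congr mx2.
- transitivity (- g%:C * (c' * c) * (e * e') * bracket w1 w2 s1 s2 r q (z + x%:C)).
    by rewrite /bracket; field; exact: k0.
  by rewrite cc ee !mulr1.
- transitivity (- (c' ^+ 2 * g%:C ^+ 2 * k) * (e * e') * bracket w1 w2 s1 s2 r r (z + x%:C)).
    by rewrite /bracket; ring.
  by rewrite ee !mulr1.
- transitivity (c ^+ 2 / k * (e * e') * bracket w1 w2 s1 s2 q q (z + x%:C)).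
    by rewrite /bracket; field; exact: k0.
  by rewrite ee !mulr1.
- transitivity (g%:C * (c' * c) * (e * e') * bracket w1 w2 s1 s2 q r (z + x%:C)).
    by rewrite /bracket; field; exact: k0.
  by rewrite cc ee !mulr1.
Qed.

Notation j1 := (jump1 w1 s1).
Notation j2 := (jump2 w1 w2 s2).

Lemma bracket_shift a b : exists P : {poly C}, forall z, complex.Im z != 0 ->
  bracket w1 w2 s1 s2 a b (z + x%:C) = P.[z] - (j1 * a.[s1] * b.[s1])%:C / (z + s%:C)
    - (j2 * a.[s2] * b.[s2])%:C / (z - s%:C).
Proof.
have [P HP] := bracketE w1 w2 s1 s2 a b.
exists (P \Po ('X + x%:C%:P)) => z bz; rewrite HP; last by rewrite complex_ImD /= addr0.
rewrite horner_comp hornerD hornerX hornerC.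
have -> : z + x%:C - s1%:C = z + s%:C by rewrite rmorphB/=; ring.
by have -> : z + x%:C - s2%:C = z - s%:C by rewrite rmorphD/=; ring.
Qed.

Definition residue_at (j : R) (t : R) : 'M[C]_2 := mx2
  (g * j * r.[t] * q.[t])%:C
  (cexp_halfV ^+ 2 * g%:C ^+ 2 * kappa * (j * r.[t] ^+ 2)%:C)
  (- (cexp_half ^+ 2 / kappa) * (j * q.[t] ^+ 2)%:C)
  (- (g * j * r.[t] * q.[t])%:C).

Lemma Phimx_residues :
  simple_poles_residues
    (fun z => dPhimx w p gamma n x z *m invmx (Phimx w p gamma n x z)) s
    (residue_at j1 s1, residue_at j2 s2).
Proof.
have [P0 H0] := bracket_shift r q; have [P1 H1] := bracket_shift r r.
have [P2 H2] := bracket_shift q q; have [P3 H3] := bracket_shift q r.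
exists (\matrix_(i < 2, j < 2) if i == 0 then
  if j == 0 then - g%:C *: P0 else - (cexp_halfV ^+ 2 * g%:C ^+ 2 * kappa) *: P1 else
  if j == 0 then cexp_half ^+ 2 / kappa *: P2 else g%:C *: P3) => z bz.
rewrite (dPhimx_mul_inv bz) (H0 z bz) (H1 z bz) (H2 z bz) (H3 z bz).
rewrite map_mx2 !mx2Z !mx2D !hornerZ !(rmorphM, rmorphXn)/=.
move: (z + _) (z - _) => u v.
congr mx2; ring.
Qed.

Lemma residuesE : residues w p gamma n x s = (residue_at j1 s1, residue_at j2 s2).
Proof.
rewrite /residues; apply: xget_unique; first exact: Phimx_residues.
by move=> A HA; apply: (residues_unique _ HA Phimx_residues); rewrite gt_eqF.
Qed.

(** Only a polynomial of degree n - 1 divided by z^n is left: e^(-(z+x)^2/2) e^(z^2/2+xz) is the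
    constant e^(-x^2/2), which accounts for the second factor [cexp_halfV]. *)
Lemma Phimx01_expands : exists c2, expands_at_infty
  (fun z => (Phimx w p gamma n x z *m pow_sigma3 n z
    *m exp_sigma3 (- (z ^+ 2 / 2 + x%:C * z))) 0 1)
  ((1%:M : 'M[C]_2) 0 1) (- kappa * g%:C * cexp_halfV ^+ 2) c2.
Proof.
have op := system_family; have [_ sz _ _] := op.
pose Q : {poly C} := (- kappa * g%:C * cexp_halfV ^+ 2) *: (map_poly (real_complex R) r \Po ('X + x%:C%:P)).
have sr : (size (map_poly (real_complex R) r \Po ('X + x%:C%:P))) = n.
  rewrite size_comp_poly2; first by rewrite size_map_poly sz prednK.
  by rewrite size_XaddC.
have sQ : (size Q <= n)%N by rewrite (leq_trans (size_scale_leq _ _))// sr.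
have [c2 H] := expands_poly sQ; exists c2.
have lead : Q`_n.-1 = - kappa * g%:C * cexp_halfV ^+ 2.
  have : lead_coef (map_poly (real_complex R) r \Po ('X + x%:C%:P)) = 1.
    rewrite lead_coef_comp ?size_XaddC// lead_coefXaddC expr1n mulr1.
    by rewrite lead_coef_map lead_coefE sz (op_lead op).
  by rewrite lead_coefE sr coefZ => ->; rewrite mulr1.
rewrite lead in H; rewrite !mxE/=.
move: H; congr expands_at_infty; apply/funext => z.
rewrite PhimxE /pow_sigma3 /exp_sigma3 !mx2_mul mxE/= opprK.
rewrite !(mulr0, mul0r, add0r, addr0) /Q hornerZ horner_comp hornerD hornerX hornerC -/(ceval _ _).
have -> : cexp_halfV = egauss (z + x%:C) * cexp (z ^+ 2 / 2 + x%:C * z).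
  rewrite /cexp_halfV /egauss -cexpD; congr cexp; rewrite rmorphM rmorphXn/= fmorphV rmorph_nat.
  by field.
ring.
Qed.

Lemma Phi1mxE : Phi1mx w p gamma n x 0 1 = - kappa * g%:C * cexp_halfV ^+ 2.
Proof.
rewrite mxE; have [c2 H] := Phimx01_expands.
apply: xget_unique; first by exists c2.
by move=> c1 [d2 H']; exact: expands_unique H' H.
Qed.

End PhiMatrix.

(** * Evolution along the shift *)

Section PearsonAlgebra.
Context {R : realFieldType}.
Variables (L J : {linear {poly R} -> R | *%R}) (p : nat -> {poly R}) (h alpha beta : nat -> R).
Hypothesis op : orthogonal_family L p h.
Hypothesis rec : forall n, 'X * p n = p n.+1 + alpha n *: p n +
  (if n is m.+1 then beta n ^+ 2 *: p m else 0).
Hypothesis LJ : forall q, L (q^`() - 2 *: 'X * q) = J q.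

Lemma op_size n : size (p n) = n.+1. Proof. by have [_ s _ _] := op. Qed.

Lemma op_deriv_size n : (size (p n)^`() <= n)%N.
Proof.
apply/leq_sizeP => j nj; rewrite coef_deriv nth_default ?mul0rn//.
by rewrite op_size.
Qed.

Lemma scaleX_mul2 q : 2 *: 'X * q = 'X * q + 'X * q :> {poly R}.
Proof. by rewrite -scalerAl scaler_nat mulr2n. Qed.

Lemma pearson_sqr n : J (p n * p n) = - 2 * alpha n * h n.
Proof.
rewrite -LJ scaleX_mul2 derivM linearB !linearD/= [p n * _^`()]mulrC.
rewrite (op_orthogonal op (op_deriv_size n) (leqnn n)) mulrA (op_alpha op rec); ring.
Qed.

Lemma deriv_op_coef n : (p n.+1)^`()`_n = n.+1%:R.
Proof. by rewrite coef_deriv (op_lead op). Qed.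

(** By degree, only p_(n+1)' p_n survives of the two derivative terms; its leading coefficient n + 1
    is the source of the parameter n in the Painlevé system. *)
Lemma pearson_mul n : J (p n.+1 * p n) = n.+1%:R * h n - 2 * h n.+1.
Proof.
rewrite -LJ scaleX_mul2 derivM linearB !linearD/= [p n.+1 * _^`()]mulrC.
rewrite (op_orthogonal op (op_deriv_size n) (leqnSn n)).
rewrite (op_coef op (op_deriv_size n.+1)) deriv_op_coef.
by rewrite (_ : 'X * (p n.+1 * p n) = 'X * p n * p n.+1) ?(op_mulX op)//; ring.
Qed.

Lemma pearson_mulX n : J ('X * (p n.+1 * p n)) =
  - (p n.+1)`_n * h n - 2 * h n.+1 * (alpha n.+1 + alpha n).
Proof.
have [_ _ h0 oo] := op.
rewrite -LJ scaleX_mul2 !derivM derivX linearB !linearD/= mul1r oo gtn_eqF// add0r mulrDr linearD/=.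
have -> : L ('X * (p n.+1 * (p n)^`())) = 0.
  rewrite (_ : _ * _ = ('X * (p n)^`()) * p n.+1); last by ring.
  apply: (op_orthogonal op (n := n.+1)) => //.
  by rewrite (leq_trans (size_polyMleq _ _))// size_polyX ltnS op_deriv_size.
have -> : L ('X * ((p n.+1)^`() * p n)) = - (p n.+1)`_n * h n.
  (* Subtracting (n + 1) p_(n+1) removes the leading term and leaves n - (n + 1) = -1 times the
     subleading coefficient. *)
  pose q := 'X * (p n.+1)^`() - n.+1%:R *: p n.+1.
  have sq : (size q <= n.+1)%N.
    apply/leq_sizeP => j; rewrite leq_eqVlt coefB coefXM coefZ => /orP[/eqP <-|nj].
      by rewrite /= deriv_op_coef (op_lead op) mulr1 subrr.
    rewrite [(p n.+1)`_j]nth_default ?op_size// mulr0 subr0; case: j nj => //= j nj.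
    by rewrite nth_default// (leq_trans (op_deriv_size _)).
  rewrite (_ : _ * _ = q * p n + n.+1%:R *: (p n.+1 * p n)); last first.
    by rewrite /q mulrBl -scalerAl; ring.
  rewrite linearD linearZ/= oo gtn_eqF// mulr0 addr0 (op_coef op sq); congr (_ * _).
  rewrite /q coefB coefXM coefZ; case: n {sq q} => [|n] /=; first by rewrite sub0r mul1r.
  rewrite coef_deriv -mulr_natl -[n.+2%:R]natr1; ring.
have -> : L ('X * ('X * (p n.+1 * p n))) = h n.+1 * (alpha n.+1 + alpha n).
  rewrite (_ : _ * _ = ('X * p n.+1) * ('X * p n)); last by ring.
  (* Only the factor 'X p_(n+1) is expanded: its part p_(n+2) is orthogonal to 'X p_n, and the other
     two give alpha_(n+1) h_(n+1) and beta_(n+1)^2 alpha_n h_n = alpha_n h_(n+1). *)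
  rewrite {1}rec !mulrDl !linearD/= -!scalerAl !linearZ/= ![_ * ('X * p n)]mulrC.
  have -> : L ('X * p n * p n.+2) = 0.
    apply: (op_orthogonal op (n := n.+2)) => //.
    by rewrite (leq_trans (size_polyMleq _ _))// size_polyX op_size.
  rewrite (op_mulX op) (op_alpha op rec) (op_beta op rec) add0r.
  have := h0 n; move: (h n) (h n.+1) => u v u0; field; exact: lt0r_neq0.
by rewrite addr0; ring.
Qed.

(** The coefficient matrix T of the monic polynomials is triangular with unit diagonal, and T M T^T
    is their Gram matrix, which is diagonal. *)
Lemma hankel_op n (M : 'M[R]_n) : (forall j k, M j k = L 'X^(j + k)) ->
  \det M = \prod_(j < n) h j.
Proof.
move=> ME; have [_ _ h0 oo] := op.
pose T : 'M[R]_n := \matrix_(i, j) (p i)`_j.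
have dT : \det T = 1.
  rewrite det_trig; last first.
    by apply/is_trig_mxP => i j ij; rewrite mxE nth_default// op_size.
  by apply: big1 => i _; rewrite mxE (op_lead op).
have TMT : T *m M *m T^T = diag_mx (\row_j h j).
  apply/matrixP => i k; rewrite !mxE.
  under eq_bigr do rewrite !mxE mulr_suml.
  have pE (l : 'I_n) : p l = \sum_(j < n) (p l)`_j *: 'X^j.
    rewrite -[LHS](coefK (p l)) poly_def op_size (big_ord_widen _ (fun j => (p l)`_j *: 'X^j) (ltn_ord l)).
    rewrite big_mkcond/=; apply: eq_bigr => j _; case: ltnP => // lj.
    by rewrite nth_default ?op_size// scale0r.
  transitivity (L (p i * p k)); last first.
    by rewrite oo -val_eqE; case: eqP => [->|].
  have -> : p i * p k = \sum_(l < n) \sum_(j < n) ((p i)`_j * (p k)`_l) *: 'X^(j + l).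
    rewrite {1}(pE i) {1}(pE k) mulr_sumr; apply: eq_bigr => l _.
    rewrite mulr_suml; apply: eq_bigr => j _.
    by rewrite -scalerAl -scalerAr scalerA exprD.
  rewrite linear_sum; apply: eq_bigr => l _; rewrite linear_sum; apply: eq_bigr => j _.
  by rewrite linearZ/= ME mxE; ring.
have := congr1 determinant TMT; rewrite !det_mulmx det_tr dT mul1r mulr1 det_diag => ->.
by apply: eq_bigr => j _; rewrite mxE.
Qed.

End PearsonAlgebra.

Section ShiftDerivative.
Context {R : realType}.
Variables (x0 : R) (L : R -> {linear {poly R} -> R | *%R}) (J : {linear {poly R} -> R | *%R}).
Hypothesis DL : forall q, is_derive x0 1 (fun u => L u q) (J q).
Hypothesis LJ : forall q, L x0 (q^`() - 2 *: 'X * q) = J q.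
Variables (P : R -> nat -> {poly R}) (h : R -> nat -> R) (alpha beta : nat -> R).
Hypothesis op : \forall u \near x0, orthogonal_family (L u) (P u) (h u).
Hypothesis rec : forall n, 'X * P x0 n = P x0 n.+1 + alpha n *: P x0 n +
  (if n is m.+1 then beta n ^+ 2 *: P x0 m else 0).

(* Differentiating the orthogonality relations and using the Pearson relation, the
   derivative of P_j along the shift is orthogonal to P_i for i < j - 1, hence it is
   2 beta_j^2 P_(j-1); the recurrence rewrites this without a case split on j. *)
Lemma op_shift_derive j (c : R -> R) : is_derive x0 1 c 1 ->
  is_derive x0 1 (fun u => (P u j).[c u])
    (2 * ((c x0 - alpha j) * (P x0 j).[c x0] - (P x0 j.+1).[c x0])).
Proof.
move=> Dc; have op0 := nbhs_singleton op; have [_ _ h0 oo] := op0.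
have [dP [HdP sdP]] := op_family_derive DL op j.
(* The total derivative of P_j along a point moving with speed 1: change of the coefficients plus
   change of the argument. *)
pose D := dP + (P x0 j)^`().
have sD : (size D <= j)%N.
  by rewrite (leq_trans (size_polyD _ _))// geq_max sdP (op_deriv_size op0).
have LD i : (i < j)%N -> L x0 (D * P x0 i) = 2 * L x0 ('X * P x0 i * P x0 j).
  move=> ij; have [dQ [HdQ sdQ]] := op_family_derive DL op i.
  have D1 := poly_derive_functional DL (poly_derive_mul HdP HdQ).
  have D2 : is_derive x0 1 (fun u => L u (P u j * P u i)) 0.
    apply: (near_eq_is_derive _ (is_derive_cst 0 x0 1)).
    near=> u; have [_ _ _ ->] : orthogonal_family (L u) (P u) (h u) by near: u.
    by rewrite gtn_eqF.
  have := @derive_val _ _ _ _ _ _ _ D1; rewrite (@derive_val _ _ _ _ _ _ _ D2).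
  rewrite -LJ scaleX_mul2 derivM linearB !linearD/= ![P x0 j * _]mulrC.
  rewrite (op_orthogonal op0 sdQ (ltnW ij)) (op_orthogonal op0 (op_deriv_size op0 i) (ltnW ij)).
  rewrite /D mulrDl linearD/= mulrA => E.
  have -> : 'X * P x0 i * P x0 j = 'X * (P x0 i * P x0 j) by ring.
  move: E; rewrite -mulrA; lra.
have DE : D = 2 *: (('X - (alpha j)%:P) * P x0 j - P x0 j.+1).
  rewrite mulrBl rec mul_polyC (op_expand op0 sD).
  clear HdP sdP; clearbody D; case: j sD LD => [|m] sD LD.
    by rewrite big_ord0 addr0 addrK subrr scaler0.
  rewrite big_ord_recr/= big1 ?add0r => [|i _].
    rewrite [X in 2 *: X](_ : _ = beta m.+1 ^+ 2 *: P x0 m); last by ring.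
    by rewrite LD// (op_mulX op0) (op_beta op0 rec) scalerA mulrA.
  rewrite LD ?(ltn_trans (ltn_ord i))//.
  rewrite (op_orthogonal op0 (n := i.+2)) ?mulr0 ?mul0r ?scale0r// ?ltnS//.
  by rewrite (leq_trans (size_polyMleq _ _))// size_polyX (op_size op0).
have := poly_derive_horner HdP Dc; rewrite mulr1 -hornerD -/D DE.
by rewrite !(hornerZ, hornerD, hornerN, hornerM, hornerX, hornerC).
Unshelve. all: by end_near. Qed.

End ShiftDerivative.

(** * Motion of the jumps along curves *)

Section JumpFunctional.
Context {R : realType}.
Implicit Types (q : {poly R}).

(** Point evaluations at the jumps, bundled as a linear form so that they can play the part of the
    derivative functional in the abstract results. *)
Definition jump_functional (a t b t' : R) q : R := a * q.[t] + b * q.[t'].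

Lemma jump_functional_is_linear a t b t' : scalar (jump_functional a t b t').
Proof. by move=> c q r; rewrite /jump_functional !(hornerD, hornerZ); ring. Qed.

HB.instance Definition _ a t b t' :=
  GRing.isLinear.Build R {poly R} R *%R (jump_functional a t b t') (jump_functional_is_linear a t b t').

End JumpFunctional.

Section Curves.
Context {R : realType}.
Variables (w1 w2 : R) (p : R -> R -> nat -> {poly R}) (gamma alpha beta : R -> R -> nat -> R).
Hypothesis hp : forall t1 t2 : R, t1 < t2 ->
  orthogonal_system (weight t1 t2 w1 w2) (p t1 t2) (gamma t1 t2) (alpha t1 t2) (beta t1 t2).
Variables (c1 c2 : R -> R) (x d1 d2 : R).
Hypothesis D1 : is_derive x 1 c1 d1.
Hypothesis D2 : is_derive x 1 c2 d2.
Hypothesis c12 : \forall u \near x, c1 u < c2 u.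

Let J := jump_functional (- (jump1 w1 (c1 x) * d1)) (c1 x) (- (jump2 w1 w2 (c2 x) * d2)) (c2 x).

Lemma wfun_curve_derive q :
  is_derive x 1 (fun u => wfun w1 w2 (c1 u) (c2 u) q) (J q).
Proof.
apply: (is_derive_eq (is_derive_wfun w1 w2 q D1 D2 c12)).
rewrite /J /jump_functional /jump1 /jump2; ring.
Qed.

Lemma family_curve : \forall u \near x, orthogonal_family
  (wfun w1 w2 (c1 u) (c2 u) : {linear {poly R} -> R | *%R}) (p (c1 u) (c2 u))
  (fun k => gamma (c1 u) (c2 u) k ^- 2).
Proof.
near=> u; have /hp : c1 u < c2 u by near: u.
exact: orthogonal_system_family.
Unshelve. all: by end_near. Qed.

Lemma norm_curve_derive j : is_derive x 1 (fun u => gamma (c1 u) (c2 u) j ^- 2)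
  (J (p (c1 x) (c2 x) j * p (c1 x) (c2 x) j)).
Proof. exact: (op_norm_derive wfun_curve_derive family_curve). Qed.

Lemma hankel_prod n t1 t2 : t1 < t2 ->
  hankel n w1 w2 t1 t2 = \prod_(j < n) gamma t1 t2 j ^- 2.
Proof.
move=> t12; apply: (hankel_op (orthogonal_system_family (hp t12))) => j k.
by rewrite mxE /wfun; apply: eq_Rintegral => t _; rewrite hornerXn.
Qed.

Lemma ln_hankel n t1 t2 : t1 < t2 ->
  ln (hankel n w1 w2 t1 t2) = \sum_(j < n) ln (gamma t1 t2 j ^- 2).
Proof.
move=> t12; rewrite hankel_prod//; have [_ gam _ _] := hp t12.
have g0 j : 0 < gamma t1 t2 j ^- 2 by rewrite invr_gt0 exprn_gt0.
elim: n => [|n IH]; first by rewrite !big_ord0 ln1.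
by rewrite !big_ord_recr/= lnM ?IH// posrE// prodr_gt0.
Qed.

Lemma ln_hankel_curve_derive n : is_derive x 1 (fun u => ln (hankel n w1 w2 (c1 u) (c2 u)))
  (\sum_(j < n) J (p (c1 x) (c2 x) j * p (c1 x) (c2 x) j) * gamma (c1 x) (c2 x) j ^+ 2).
Proof.
have [_ gam _ _] := hp (nbhs_singleton c12).
apply: (@near_eq_is_derive _ _ _ (fun u => \sum_(j < n) ln (gamma (c1 u) (c2 u) j ^- 2))).
  by near=> u; rewrite ln_hankel//; near: u.
apply: is_derive_sumf => j _.
have g0 : 0 < gamma (c1 x) (c2 x) j ^- 2 by rewrite invr_gt0 exprn_gt0.
apply: (is_derive_eq (is_derive_compf (norm_curve_derive j) (is_derive1_ln g0))).
by rewrite invrK mulrC.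
Unshelve. all: by end_near. Qed.

End Curves.

Lemma four_pi_iE (R : realType) : 0 +i* (4 * pi) = 2 * two_pi_i R.
Proof.
by apply: complex_eqP; rewrite /= ?mulr0 ?mul0r ?addr0 ?subr0//; ring.
Qed.

(** * Real formulas for a_k, b_k, y and their differential equations *)

Section Assembly.
Context {R : realType}.
Notation C := (R[i]).
Variables (m : nat) (w1 w2 : R) (p : R -> R -> nat -> {poly R}) (gamma alpha beta : R -> R -> nat -> R).
Hypothesis hw12 : w1 != w2.
Hypothesis hw11 : w1 != 1.
Hypothesis hp : forall t1 t2 : R, t1 < t2 ->
  orthogonal_system (weight t1 t2 w1 w2) (p t1 t2) (gamma t1 t2) (alpha t1 t2) (beta t1 t2).
Variable s : R.
Hypothesis s0 : 0 < s.
Notation n := (m.+1).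

Let lt_shift (u : R) : u - s < u + s := shift_lt u s0.

(* prev and cur are the values at the two jumps of the polynomials of index n - 1 and n. *)
Definition gamma_sqr (u : R) : R := gamma (u - s) (u + s) m ^+ 2.
Definition jump1_at (u : R) : R := jump1 w1 (u - s).
Definition jump2_at (u : R) : R := jump2 w1 w2 (u + s).
Definition prev1_at (u : R) : R := (p (u - s) (u + s) m).[u - s].
Definition prev2_at (u : R) : R := (p (u - s) (u + s) m).[u + s].
Definition cur1_at (u : R) : R := (p (u - s) (u + s) n).[u - s].
Definition cur2_at (u : R) : R := (p (u - s) (u + s) n).[u + s].
Definition a1_real (u : R) : R := gamma_sqr u * jump1_at u * prev1_at u ^+ 2 / 2.
Definition a2_real (u : R) : R := gamma_sqr u * jump2_at u * prev2_at u ^+ 2 / 2.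
Definition b1_real (u : R) : R := 2 * cur1_at u / prev1_at u.
Definition b2_real (u : R) : R := 2 * cur2_at u / prev2_at u.

Lemma gamma_sqr_gt0 u : 0 < gamma_sqr u.
Proof. by have [_ gam _ _] := hp (lt_shift u); rewrite exprn_gt0. Qed.

Lemma jump1_at_neq0 u : jump1_at u != 0.
Proof. by rewrite mulf_neq0 ?subr_eq0// gt_eqF// expR_gt0. Qed.

Lemma jump2_at_neq0 u : jump2_at u != 0.
Proof. by rewrite mulf_neq0// ?subr_eq0 1?[w2 == _]eq_sym// gt_eqF// expR_gt0. Qed.

Lemma cexp_real (r : R) : cexp (r%:C) = (expR r)%:C.
Proof. by rewrite /cexp /= cos0 sin0 -complexr0 mulr1. Qed.

Lemma cexp_halfV_sqr (u : R) : cexp_halfV u ^+ 2 = (expR (- u ^+ 2))%:C.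
Proof.
rewrite /cexp_halfV -rmorphN cexp_real -rmorphXn/= -expRM_natl; congr (expR _)%:C; lra.
Qed.

Lemma y_funE u : y_fun n w1 w2 p gamma u s = (0 +i* (4 * pi)) * (gamma_sqr u * expR (- u ^+ 2))%:C.
Proof.
rewrite /y_fun (Phi1mxE (hp (lt_shift u)) (ltn0Sn m)) cexp_halfV_sqr rmorphM/= /two_pi_i /gamma_sqr.
rewrite four_pi_iE /two_pi_i.
ring.
Qed.

Lemma four_pi_i_neq0 : 0 +i* (4 * pi) != 0 :> C.
Proof.
apply/eqP => /(congr1 (@complex.Im R))/= /eqP; rewrite mulf_eq0 pnatr_eq0/=.
by rewrite gt_eqF// pi_gt0.
Qed.

Lemma real_neq0 (r : R) : (r%:C != 0) = (r != 0).
Proof. by rewrite -(rmorph0 (real_complex R)) (inj_eq (@complexI R)). Qed.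

Lemma A_funE u : A_fun n w1 w2 p gamma u s =
  (residue_at u (p (u - s) (u + s)) (gamma (u - s) (u + s)) n (jump1_at u) (u - s),
   residue_at u (p (u - s) (u + s)) (gamma (u - s) (u + s)) n (jump2_at u) (u + s)).
Proof. exact: (residuesE s0 (hp (lt_shift u))). Qed.

Lemma a_ratio (u j t : R) : residue_at u (p (u - s) (u + s)) (gamma (u - s) (u + s)) n j t 0 1
  / y_fun n w1 w2 p gamma u s = (gamma_sqr u * j * (p (u - s) (u + s) m).[t] ^+ 2 / 2)%:C.
Proof.
rewrite y_funE /residue_at mxE/= cexp_halfV_sqr -/(gamma_sqr u).
rewrite four_pi_iE.
have k0 := @kappa_neq0 R; have g0 := lt0r_neq0 (gamma_sqr_gt0 u).
have e0 := lt0r_neq0 (expR_gt0 (- u ^+ 2)).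
move: (two_pi_i R) (gamma_sqr u) (expR _) (_.[t]) k0 g0 e0 => k g e v k0.
rewrite -!real_neq0 !rmorphM fmorphV rmorph_nat/= => g0 e0.
by field; rewrite k0 g0 e0.
Qed.

(* Where the polynomial of index m vanishes at t, both sides are 0, because x / 0 = 0. *)
Lemma b_ratio (u j t : R) : j != 0 ->
  residue_at u (p (u - s) (u + s)) (gamma (u - s) (u + s)) n j t 0 0
   / (gamma_sqr u * j * (p (u - s) (u + s) m).[t] ^+ 2 / 2)%:C
  = (2 * (p (u - s) (u + s) n).[t] / (p (u - s) (u + s) m).[t])%:C.
Proof.
move=> j0; rewrite /residue_at mxE/= -/(gamma_sqr u) -fmorph_div; congr (real_complex R _).
have := gamma_sqr_gt0 u; move: (gamma_sqr u) => g /lt0r_neq0 g0.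
have [->|r0] := eqVneq ((p (u - s) (u + s) m).[t]) 0.
  by rewrite expr0n/= !(mulr0, mul0r, invr0).
by field; rewrite j0 g0 r0.
Qed.

Lemma a1_funE u : a1_fun n w1 w2 p gamma u s = (a1_real u)%:C.
Proof. by rewrite /a1_fun A_funE; exact: a_ratio. Qed.

Lemma a2_funE u : a2_fun n w1 w2 p gamma u s = (a2_real u)%:C.
Proof. by rewrite /a2_fun A_funE; exact: a_ratio. Qed.

Lemma b1_funE u : b1_fun n w1 w2 p gamma u s = (b1_real u)%:C.
Proof. by rewrite /b1_fun a1_funE A_funE; apply: b_ratio; exact: jump1_at_neq0. Qed.

Lemma b2_funE u : b2_fun n w1 w2 p gamma u s = (b2_real u)%:C.
Proof. by rewrite /b2_fun a2_funE A_funE; apply: b_ratio; exact: jump2_at_neq0. Qed.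

Variable x : R.
Notation s1 := (x - s).
Notation s2 := (x + s).
Notation am := (alpha s1 s2 m).
Notation an := (alpha s1 s2 n).
Notation bn := (beta s1 s2 n).
Notation hm := (gamma s1 s2 m ^- 2).
Notation hn := (gamma s1 s2 n ^- 2).

Let Dc (c : R) : is_derive x 1 (fun u : R => u + c) 1.
Proof. by have := is_derive_addf (is_derive_id x 1) (is_derive_cst c x 1); rewrite addr0. Qed.

Let near_lt : \forall u \near x, u - s < u + s.
Proof. by near=> u; exact: lt_shift. Unshelve. all: by end_near. Qed.

(** The factors 1 are the speeds of the two jumps under the shift. With equal speeds the derivative
    of the functional coincides with the Pearson functional. *)
Let J : {linear {poly R} -> R | *%R} := jump_functional (- (jump1_at x * 1)) s1 (- (jump2_at x * 1)) s2.

Let DL q : is_derive x 1 (fun u => wfun w1 w2 (u - s) (u + s) q) (J q).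
Proof. exact: (wfun_curve_derive w1 w2 (Dc (- s)) (Dc s) near_lt). Qed.

Let LJ q : wfun w1 w2 s1 s2 (q^`() - 2 *: 'X * q) = J q.
Proof.
rewrite wfun_pearson// /J /= /jump_functional /jump1_at /jump2_at /jump1 /jump2; ring.
Qed.

Let op := family_curve hp near_lt.
Let op0 : orthogonal_family (wfun w1 w2 s1 s2 : {linear {poly R} -> R | *%R}) (p s1 s2) (fun k => gamma s1 s2 k ^- 2).
Proof. exact: orthogonal_system_family (hp (lt_shift x)). Qed.
Let rec : forall k, 'X * p s1 s2 k = p s1 s2 k.+1 + alpha s1 s2 k *: p s1 s2 k +
  (if k is l.+1 then beta s1 s2 k ^+ 2 *: p s1 s2 l else 0).
Proof. by have [_ _ _] := hp (lt_shift x). Qed.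

Lemma pearson_jumpE q : J q = - (jump1_at x * q.[s1] + jump2_at x * q.[s2]).
Proof. by rewrite /J /= /jump_functional; ring. Qed.

Lemma gamma_sqrE : gamma_sqr x = hm^-1. Proof. by rewrite invrK. Qed.

Lemma hm_gt0 : 0 < hm. Proof. by rewrite -[hm]invrK -gamma_sqrE invr_gt0 gamma_sqr_gt0. Qed.
Lemma hn_gt0 : 0 < hn. Proof. by have [_ gam _ _] := hp (lt_shift x); rewrite invr_gt0 exprn_gt0. Qed.

Lemma beta_sqr : bn ^+ 2 = hn * gamma_sqr x.
Proof. by rewrite (op_beta op0 rec) invrK. Qed.

Lemma jump_sum_am : jump1_at x * prev1_at x ^+ 2 + jump2_at x * prev2_at x ^+ 2 = 2 * am * hm.
Proof.
have := pearson_sqr op0 rec LJ m; rewrite pearson_jumpE !hornerM -!expr2 -/(prev1_at x) -/(prev2_at x); lra.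
Qed.

Lemma jump_sum_an : jump1_at x * cur1_at x ^+ 2 + jump2_at x * cur2_at x ^+ 2 = 2 * an * hn.
Proof.
have := pearson_sqr op0 rec LJ n; rewrite pearson_jumpE !hornerM -!expr2 -/(cur1_at x) -/(cur2_at x); lra.
Qed.

Lemma jump_sum_beta : jump1_at x * (cur1_at x * prev1_at x) + jump2_at x * (cur2_at x * prev2_at x) = 2 * hn - n%:R * hm.
Proof.
have := pearson_mul op0 LJ m; rewrite pearson_jumpE !hornerM -/(prev1_at x) -/(prev2_at x) -/(cur1_at x) -/(cur2_at x); lra.
Qed.

Lemma jump_sum_subleading :
  jump1_at x * (s1 * (cur1_at x * prev1_at x)) + jump2_at x * (s2 * (cur2_at x * prev2_at x)) =
  (p s1 s2 n)`_m * hm + 2 * hn * (an + am).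
Proof.
have := pearson_mulX op0 rec LJ m; rewrite pearson_jumpE !hornerM !hornerX -/(prev1_at x) -/(prev2_at x) -/(cur1_at x) -/(cur2_at x); lra.
Qed.

(** This is the Pearson relation for p_(n-1)^2, divided by 2 h_(n-1). It turns every alpha_(n-1) in
    the derivatives below into a_1 + a_2. *)
Lemma a_sum : a1_real x + a2_real x = am.
Proof.
have := jump_sum_am; rewrite /a1_real /a2_real gamma_sqrE; have := hm_gt0; move: hm => h /lt0r_neq0 h0 E.
have -> : am = (jump1_at x * prev1_at x ^+ 2 + jump2_at x * prev2_at x ^+ 2) / (2 * h) by rewrite E; field.
by field.
Qed.

Lemma a1_real_neq0 u : a1_real u != 0 -> prev1_at u != 0.
Proof. by apply: contra => /eqP r0; rewrite /a1_real r0 expr0n/= mulr0 mul0r. Qed.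

Lemma ab1E : a1_real x != 0 -> a1_real x * b1_real x = gamma_sqr x * jump1_at x * (cur1_at x * prev1_at x).
Proof.
move=> /a1_real_neq0 r0; rewrite /a1_real /b1_real; field; exact: r0.
Qed.

Lemma a2_real_neq0 u : a2_real u != 0 -> prev2_at u != 0.
Proof. by apply: contra => /eqP r0; rewrite /a2_real r0 expr0n/= mulr0 mul0r. Qed.

Lemma ab2E : a2_real x != 0 -> a2_real x * b2_real x = gamma_sqr x * jump2_at x * (cur2_at x * prev2_at x).
Proof.
move=> /a2_real_neq0 r0; rewrite /a2_real /b2_real; field; exact: r0.
Qed.

(** Here a_1 != 0 matters: at a zero of p_(n-1) the left side is 0 by the convention for division by
    0, whereas the right side is not, because consecutive orthogonal polynomials have no common
    zero. *)
Lemma abb1E : a1_real x != 0 -> a1_real x * b1_real x ^+ 2 = 2 * gamma_sqr x * jump1_at x * cur1_at x ^+ 2.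
Proof.
move=> /a1_real_neq0 r0; rewrite /a1_real /b1_real; field; exact: r0.
Qed.

Lemma abb2E : a2_real x != 0 -> a2_real x * b2_real x ^+ 2 = 2 * gamma_sqr x * jump2_at x * cur2_at x ^+ 2.
Proof.
move=> /a2_real_neq0 r0; rewrite /a2_real /b2_real; field; exact: r0.
Qed.

Lemma ab_sum : a1_real x != 0 -> a2_real x != 0 -> a1_real x * b1_real x + a2_real x * b2_real x + n%:R = 2 * bn ^+ 2.
Proof.
move=> /ab1E -> /ab2E ->; rewrite beta_sqr; have := jump_sum_beta; rewrite gamma_sqrE.
have := hm_gt0; move: hm (hn) => h h' /lt0r_neq0 h0 E.
have -> : 2 * (h' * h^-1) = (2 * h' - n%:R * h) / h + n%:R by field.
by rewrite -E; field.
Qed.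

Lemma abb_sum : a1_real x != 0 -> a2_real x != 0 -> a1_real x * b1_real x ^+ 2 + a2_real x * b2_real x ^+ 2 = 4 * bn ^+ 2 * an.
Proof.
move=> /abb1E -> /abb2E ->; rewrite beta_sqr.
have -> : 4 * (hn * gamma_sqr x) * an = 2 * gamma_sqr x * (2 * an * hn) by ring.
rewrite -jump_sum_an; ring.
Qed.

Lemma subleading_sum : a1_real x != 0 -> a2_real x != 0 -> (p s1 s2 n)`_m =
  a1_real x * b1_real x * s1 + a2_real x * b2_real x * s2 - 2 * bn ^+ 2 * (an + am).
Proof.
move=> /ab1E -> /ab2E ->; rewrite beta_sqr; have := jump_sum_subleading; rewrite gamma_sqrE.
have := hm_gt0; move: hm (hn) ((p s1 s2 n)`_m) => h h' c /lt0r_neq0 h0 E.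
have -> : c = ((c * h + 2 * h' * (an + am)) - 2 * h' * (an + am)) / h by field.
by rewrite -E; field.
Qed.

Lemma is_derive_gamma_sqr : is_derive x 1 gamma_sqr (2 * am * gamma_sqr x).
Proof.
have := @is_derive_invf _ _ (fun u : R => gamma (u - s) (u + s) m ^- 2) x 1 _
  (lt0r_neq0 hm_gt0) (op_norm_derive DL op m).
rewrite (pearson_sqr op0 rec LJ) gamma_sqrE.
have -> : - (- 2 * am * hm) / hm ^+ 2 = 2 * am * hm^-1.
  by have := hm_gt0; move: hm => h /lt0r_neq0 h0; field.
by apply: is_derive_ext => u; rewrite invrK.
Qed.

Lemma is_derive_gauss_shift (k c : R) :
  is_derive x 1 (fun u => k * expR (- (u + c) ^+ 2)) (- 2 * (x + c) * (k * expR (- (x + c) ^+ 2))).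
Proof.
have D := is_derive_oppf (is_derive_expf 2 (Dc c)).
apply: (is_derive_eq (is_derive_scalef k (is_derive_compf D (is_derive_expR _)))).
by rewrite /= expr1; ring.
Qed.

Lemma is_derive_jump1_at : is_derive x 1 jump1_at (- 2 * s1 * jump1_at x).
Proof. exact: is_derive_gauss_shift. Qed.

Lemma is_derive_jump2_at : is_derive x 1 jump2_at (- 2 * s2 * jump2_at x).
Proof. exact: is_derive_gauss_shift. Qed.

Lemma is_derive_prev1_at : is_derive x 1 prev1_at (2 * ((s1 - am) * prev1_at x - cur1_at x)).
Proof. exact: (op_shift_derive DL LJ op rec m (Dc (- s))). Qed.

Lemma is_derive_prev2_at : is_derive x 1 prev2_at (2 * ((s2 - am) * prev2_at x - cur2_at x)).
Proof. exact: (op_shift_derive DL LJ op rec m (Dc s)). Qed.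

(** The shift derivative of p_n brings in p_(n+1); the recurrence leads back to the indices n - 1
    and n, where the system closes. *)
Lemma rec_horner t : (p s1 s2 n.+1).[t] = (t - an) * (p s1 s2 n).[t] - bn ^+ 2 * (p s1 s2 m).[t].
Proof.
have /(congr1 (fun q : {poly R} => q.[t])) := rec n.
rewrite !(hornerM, hornerX, hornerD, hornerZ); lra.
Qed.

Lemma is_derive_cur1_at : is_derive x 1 cur1_at (2 * bn ^+ 2 * prev1_at x).
Proof.
apply: (is_derive_eq (op_shift_derive DL LJ op rec n (Dc (- s)))).
by rewrite rec_horner /prev1_at; ring.
Qed.

Lemma is_derive_cur2_at : is_derive x 1 cur2_at (2 * bn ^+ 2 * prev2_at x).
Proof.
apply: (is_derive_eq (op_shift_derive DL LJ op rec n (Dc s))).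
by rewrite rec_horner /prev2_at; ring.
Qed.

(** The logarithmic derivatives of gamma_(n-1)^2, of the jump and of the squared value of p_(n-1)
    are 2 alpha_(n-1), -2 s1 and 4 (s1 - alpha_(n-1)) - 2 b_1; their sum is the stated factor. *)
Lemma is_derive_a1_real : a1_real x != 0 ->
  is_derive x 1 a1_real (- 2 * a1_real x * (a1_real x + a2_real x + b1_real x - x + s)).
Proof.
move=> /a1_real_neq0 r0; rewrite a_sum.
have D := is_derive_mulf (is_derive_mulf (is_derive_mulf is_derive_gamma_sqr is_derive_jump1_at)
  (is_derive_expf 2 is_derive_prev1_at)) (is_derive_cst (2^-1 : R) x 1).
apply: is_derive_eq (is_derive_ext (g := a1_real) (fun=> erefl) D) _.
by rewrite /= expr1 /a1_real /b1_real; field.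
Qed.

Lemma is_derive_a2_real : a2_real x != 0 ->
  is_derive x 1 a2_real (- 2 * a2_real x * (a1_real x + a2_real x + b2_real x - x - s)).
Proof.
move=> /a2_real_neq0 r0; rewrite a_sum.
have D := is_derive_mulf (is_derive_mulf (is_derive_mulf is_derive_gamma_sqr is_derive_jump2_at)
  (is_derive_expf 2 is_derive_prev2_at)) (is_derive_cst (2^-1 : R) x 1).
apply: is_derive_eq (is_derive_ext (g := a2_real) (fun=> erefl) D) _.
by rewrite /= expr1 /a2_real /b2_real; field.
Qed.

Lemma is_derive_b1_real : a1_real x != 0 -> a2_real x != 0 ->
  is_derive x 1 b1_real (b1_real x ^+ 2 + 2 * b1_real x * (2 * a1_real x + a2_real x - x + s)
    + 2 * (a2_real x * b2_real x + n%:R)).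
Proof.
move=> a10 a20; have r0 := a1_real_neq0 a10.
(* Moving the term 2 a_1 b_1 from one summand to the other exhibits the two known sums, a_1 + a_2 =
   alpha_(n-1) and a_1 b_1 + a_2 b_2 + n = 2 beta_n^2. *)
have -> : b1_real x ^+ 2 + 2 * b1_real x * (2 * a1_real x + a2_real x - x + s) + 2 * (a2_real x * b2_real x + n%:R)
    = b1_real x ^+ 2 + 2 * b1_real x * ((a1_real x + a2_real x) - s1) + 2 * (a1_real x * b1_real x + a2_real x * b2_real x + n%:R).
  ring.
rewrite ab_sum// a_sum.
have D := is_derive_mulf (is_derive_scalef 2 is_derive_cur1_at) (is_derive_invf r0 is_derive_prev1_at).
apply: is_derive_eq (is_derive_ext (g := b1_real) (fun=> erefl) D) _.
by rewrite /b1_real; field.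
Qed.

Lemma is_derive_b2_real : a1_real x != 0 -> a2_real x != 0 ->
  is_derive x 1 b2_real (b2_real x ^+ 2 + 2 * b2_real x * (a1_real x + 2 * a2_real x - x - s)
    + 2 * (a1_real x * b1_real x + n%:R)).
Proof.
move=> a10 a20; have r0 := a2_real_neq0 a20.
have -> : b2_real x ^+ 2 + 2 * b2_real x * (a1_real x + 2 * a2_real x - x - s) + 2 * (a1_real x * b1_real x + n%:R)
    = b2_real x ^+ 2 + 2 * b2_real x * ((a1_real x + a2_real x) - s2) + 2 * (a1_real x * b1_real x + a2_real x * b2_real x + n%:R).
  ring.
rewrite ab_sum// a_sum.
have D := is_derive_mulf (is_derive_scalef 2 is_derive_cur2_at) (is_derive_invf r0 is_derive_prev2_at).
apply: is_derive_eq (is_derive_ext (g := b2_real) (fun=> erefl) D) _.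
by rewrite /b2_real; field.
Qed.

Lemma is_derive_y : is_derive x 1 (fun u => gamma_sqr u * expR (- u ^+ 2))
  (2 * (a1_real x + a2_real x - x) * (gamma_sqr x * expR (- x ^+ 2))).
Proof.
have := is_derive_gauss_shift 1 0; rewrite addr0 => D; rewrite a_sum.
have D' : is_derive x 1 (fun u => expR (- u ^+ 2)) (- 2 * x * expR (- x ^+ 2)).
  rewrite -[expR (- x ^+ 2)]mul1r; apply: is_derive_ext D => u.
  by rewrite addr0 mul1r.
by apply: (is_derive_eq (is_derive_mulf is_derive_gamma_sqr D')); ring.
Qed.

Lemma is_derive_ln_gamma : is_derive x 1 (fun u => ln (gamma (u - s) (u + s) m)) (a1_real x + a2_real x).
Proof.
have D := is_derive_scalef 2^-1 (is_derive_compf is_derive_gamma_sqr (is_derive1_ln (gamma_sqr_gt0 x))).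
apply: is_derive_eq (is_derive_ext _ D) _.
  move=> u; have [_ gam _ _] := hp (lt_shift u).
  by rewrite /gamma_sqr lnXn// mulr2n; field.
by rewrite a_sum; have /lt0r_neq0 := gamma_sqr_gt0 x; move: (gamma_sqr x) => g0 ?; field.
Qed.

(** The two partial derivatives add up to the derivative along the shift, to which each ln h_j
    contributes -2 alpha_j; minus the sum of the alpha_j for j < n is the subleading coefficient. *)
Lemma F_hankel_subleading : F_hankel n w1 w2 s1 s2 = 2 * (p s1 s2 n)`_m.
Proof.
have lt1 : \forall u \near s1, u < s2 by near=> u; near: u; exact: lt_nbhsl.
have lt2 : \forall u \near s2, s1 < u by near=> u; near: u; exact: lt_nbhsr.
have E1 := ln_hankel_curve_derive hp (is_derive_id s1 1) (is_derive_cst s2 s1 1) lt1 n.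
have E2 := ln_hankel_curve_derive hp (is_derive_cst s1 s2 1) (is_derive_id s2 1) lt2 n.
rewrite /F_hankel !derive1E (@derive_val _ _ _ _ _ _ _ E1) (@derive_val _ _ _ _ _ _ _ E2).
rewrite -big_split/= (op_subleading op0 rec) mulrN mulr_sumr -sumrN; apply: eq_bigr => i _.
have [_ gam _ _] := hp (lt_shift x).
have g0 : gamma s1 s2 i != 0 by rewrite gt_eqF.
have := pearson_sqr op0 rec LJ i; rewrite pearson_jumpE /jump_functional => E.
transitivity (- 2 * alpha s1 s2 i * gamma s1 s2 i ^- 2 * gamma s1 s2 i ^+ 2); last by field.
rewrite -E /jump1_at /jump2_at; ring.
Unshelve. all: by end_near. Qed.

Lemma derivable_ln_hankel1 : derivable (fun u : R => ln (hankel n w1 w2 u s2)) s1 1.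
Proof.
have lt1 : \forall u \near s1, u < s2 by near=> u; near: u; exact: lt_nbhsl.
by have [] := ln_hankel_curve_derive hp (is_derive_id s1 1) (is_derive_cst s2 s1 1) lt1 n.
Unshelve. all: by end_near. Qed.

Lemma derivable_ln_hankel2 : derivable (fun u : R => ln (hankel n w1 w2 s1 u)) s2 1.
Proof.
have lt2 : \forall u \near s2, s1 < u by near=> u; near: u; exact: lt_nbhsr.
by have [] := ln_hankel_curve_derive hp (is_derive_cst s1 s2 1) (is_derive_id s2 1) lt2 n.
Unshelve. all: by end_near. Qed.

End Assembly.

Lemma is_derive_RC_real_eq (R : realType) (f : R -> R[i]) (fr : R -> R) (x a : R) (l : R[i]) :
  (forall u, f u = (fr u)%:C) -> is_derive x 1 fr a -> l = a%:C -> is_derive_RC f x l.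
Proof. by move=> /funext -> D ->; exact: is_derive_RC_real. Qed.

Lemma is_derive_RC_cst (R : realType) (c : R[i]) (x : R) : is_derive_RC (fun=> c) x 0.
Proof. by split; exact: is_derive_cst. Qed.

Ltac real_complex_simpl :=
  rewrite ?(rmorphD, rmorphB, rmorphN, rmorphM, rmorphXn, fmorphV, rmorph_nat, rmorph1)/=.

Unset Implicit Arguments.

Theorem theorem1 (R : realType) (n : nat) (w1 w2 : R)
    (p : R -> R -> nat -> {poly R}) (gamma alpha beta : R -> R -> nat -> R)
    (hn : (1 <= n)%N) (hw1 : 0 <= w1) (hw2 : 0 <= w2)
    (hw12 : w1 != w2) (hw11 : w1 != 1)
    (hp : forall t1 t2 : R, t1 < t2 ->
       orthogonal_system (weight t1 t2 w1 w2)
         (p t1 t2) (gamma t1 t2) (alpha t1 t2) (beta t1 t2))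
    (s1 s2 : R) (hs : s1 < s2) :
  let x : R := (s1 + s2) / 2 in
  let s : R := (s2 - s1) / 2 in
  let yf (u : R) : R[i] := y_fun n w1 w2 p gamma u s in
  let a1f (u : R) : R[i] := a1_fun n w1 w2 p gamma u s in
  let a2f (u : R) : R[i] := a2_fun n w1 w2 p gamma u s in
  let b1f (u : R) : R[i] := b1_fun n w1 w2 p gamma u s in
  let b2f (u : R) : R[i] := b2_fun n w1 w2 p gamma u s in
  let xc : R[i] := x%:C in
  let sc : R[i] := s%:C in
  let nc : R[i] := n%:R in
  let y : R[i] := yf x in
  let a1 : R[i] := a1f x in
  let a2 : R[i] := a2f x in
  let b1 : R[i] := b1f x in
  let b2 : R[i] := b2f x in
  (* each identity assumes a_k <> 0 exactly for those k whose b_k it mentions *)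
  [/\ [/\ a1 != 0 ->
          is_derive_RC a1f x (- 2 * a1 * (a1 + a2 + b1 - xc + sc)),
          a2 != 0 ->
          is_derive_RC a2f x (- 2 * a2 * (a1 + a2 + b2 - xc - sc)),
          a1 != 0 -> a2 != 0 ->
          is_derive_RC b1f x
            (b1 ^+ 2 + 2 * b1 * (2 * a1 + a2 - xc + sc) + 2 * (a2 * b2 + nc)),
          a1 != 0 -> a2 != 0 ->
          is_derive_RC b2f x
            (b2 ^+ 2 + 2 * b2 * (a1 + 2 * a2 - xc - sc) + 2 * (a1 * b1 + nc))
        & is_derive_RC yf x (2 * (a1 + a2 - xc) * y)],
      [/\ derivable (fun u : R => ln (hankel n w1 w2 u s2)) s1 1,
          derivable (fun u : R => ln (hankel n w1 w2 s1 u)) s2 1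
        & a1 != 0 -> a2 != 0 ->
          (F_hankel n w1 w2 s1 s2)%:C = H_IV n a1 a2 b1 b2 xc sc - 2 * nc * xc],
      a1 != 0 -> a2 != 0 ->
        (alpha s1 s2 n)%:C =
          (a1 * b1 ^+ 2 + a2 * b2 ^+ 2) / (2 * (a1 * b1 + a2 * b2 + nc)) /\
        (beta s1 s2 n ^+ 2)%:C = 2^-1 * (a1 * b1 + a2 * b2 + nc),
      [/\ (gamma s1 s2 n.-1 ^+ 2)%:C =
            (0 +i* (4 * pi))^-1 * (expR (x ^+ 2))%:C * y,
          (0 +i* (4 * pi))^-1 * (expR (x ^+ 2))%:C * y != 0
        & is_derive_RC (fun u : R => (ln (gamma (u - s) (u + s) n.-1))%:C) x
            (a1 + a2)]
    & (a1 != 0 ->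
        ((p s1 s2 n).[s1] ^+ 2)%:C =
          two_pi_i R / (w1 - 1)%:C * (expR (- 2 * s * x + s ^+ 2))%:C
            * (a1 * b1 ^+ 2 / y)) /\
      (a2 != 0 ->
        ((p s1 s2 n).[s2] ^+ 2)%:C =
          two_pi_i R / (w2 - w1)%:C * (expR (2 * s * x + s ^+ 2))%:C
            * (a2 * b2 ^+ 2 / y))].
Proof.
case: n hn => [//|m] _.
have xs1 : s1 = (s1 + s2) / 2 - (s2 - s1) / 2 by lra.
have xs2 : s2 = (s1 + s2) / 2 + (s2 - s1) / 2 by lra.
have s0 : 0 < (s2 - s1) / 2 by rewrite divr_gt0// subr_gt0.
(* From here on x and s are the independent variables and the jumps are x - s and x + s. *)
move=> x s; rewrite -/x -/s in xs1 xs2 s0; clearbody x s; subst s1 s2.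
move=> yf a1f a2f b1f b2f xc sc nc y a1 a2 b1 b2.
have yE u : yf u = (0 +i* (4 * pi)) * (gamma_sqr m gamma s u * expR (- u ^+ 2))%:C.
  exact: (y_funE m hp s0).
have a1E u : a1f u = (a1_real m w1 p gamma s u)%:C by exact: (a1_funE m hp s0).
have a2E u : a2f u = (a2_real m w1 w2 p gamma s u)%:C by exact: (a2_funE m hp s0).
have b1E u : b1f u = (b1_real m p s u)%:C by exact: (b1_funE m hw11 hp s0).
have b2E u : b2f u = (b2_real m p s u)%:C by exact: (b2_funE m hw12 hp s0).
have A10 : a1 != 0 -> a1_real m w1 p gamma s x != 0 by rewrite /a1 a1E real_neq0.
have A20 : a2 != 0 -> a2_real m w1 w2 p gamma s x != 0 by rewrite /a2 a2E real_neq0.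
have G0 := lt0r_neq0 (gamma_sqr_gt0 m hp s0 x).
have e0 := lt0r_neq0 (expR_gt0 (- x ^+ 2)).
have ncE : nc = (m.+1%:R : R)%:C by rewrite rmorph_nat.
rewrite /y /a1 /a2 /b1 /b2 yE a1E a2E b1E b2E ncE in A10 A20 *.
split.
- split.
  + move=> /A10 a10; apply: (is_derive_RC_real_eq a1E (is_derive_a1_real hp s0 a10)).
    by move: (a1_real _ _ _ _ _ _) (a2_real _ _ _ _ _ _ _) (b1_real _ _ _ _) => *; real_complex_simpl.
  + move=> /A20 a20; apply: (is_derive_RC_real_eq a2E (is_derive_a2_real hp s0 a20)).
    by move: (a1_real _ _ _ _ _ _) (a2_real _ _ _ _ _ _ _) (b2_real _ _ _ _) => *; real_complex_simpl.
  + move=> /A10 a10 /A20 a20; apply: (is_derive_RC_real_eq b1E (is_derive_b1_real hp s0 a10 a20)).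
    move: (a1_real _ _ _ _ _ _) (a2_real _ _ _ _ _ _ _) (b1_real _ _ _ _) (b2_real _ _ _ _) => *.
    by real_complex_simpl.
  + move=> /A10 a10 /A20 a20; apply: (is_derive_RC_real_eq b2E (is_derive_b2_real hp s0 a10 a20)).
    move: (a1_real _ _ _ _ _ _) (a2_real _ _ _ _ _ _ _) (b1_real _ _ _ _) (b2_real _ _ _ _) => *.
    by real_complex_simpl.
  + have := is_derive_RC_mul (is_derive_RC_cst (0 +i* (4 * pi)) x) (is_derive_RC_real (is_derive_y m hp s0 x)).
    rewrite (_ : yf = fun u => (0 +i* (4 * pi)) * (gamma_sqr m gamma s u * expR (- u ^+ 2))%:C); last exact/funext.
    congr is_derive_RC; rewrite mul0r add0r.
    move: (a1_real _ _ _ _ _ _) (a2_real _ _ _ _ _ _ _) (_ * expR _) => A1 A2 B.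
    by real_complex_simpl; ring.
- split; [exact: (derivable_ln_hankel1 hp s0)|exact: (derivable_ln_hankel2 hp s0)|].
  move=> /A10 a10 /A20 a20; rewrite (F_hankel_subleading m hp s0 x) (subleading_sum hp s0 a10 a20).
  rewrite mulrDr mulrN; set X := 2 * (2 * _ * _).
  (* X is 4 beta_n^2 (alpha_n + alpha_(n-1)). Its first half is the sum of the a_k b_k^2, its second
     half 2 (a_1 b_1 + a_2 b_2 + n) (a_1 + a_2): the negative terms of the Hamiltonian. *)
  have -> : X = (a1_real m w1 p gamma s x * b1_real m p s x ^+ 2 + a2_real m w1 w2 p gamma s x * b2_real m p s x ^+ 2)
     + 2 * (a1_real m w1 p gamma s x * b1_real m p s x + a2_real m w1 w2 p gamma s x * b2_real m p s x + m.+1%:R)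
       * (a1_real m w1 p gamma s x + a2_real m w1 w2 p gamma s x).
    by rewrite (abb_sum hp s0 a10 a20) (ab_sum hp s0 a10 a20) (a_sum m hp s0 x) /X; ring.
  rewrite /H_IV -/nc ncE.
  move: (a1_real _ _ _ _ _ _) (a2_real _ _ _ _ _ _ _) (b1_real _ _ _ _) (b2_real _ _ _ _) (m.+1%:R : R) => A1 A2 B1 B2 N.
  by rewrite /xc /sc; real_complex_simpl; ring.
- move=> /A10 a10 /A20 a20.
  have ab := ab_sum hp s0 a10 a20; have abb := abb_sum hp s0 a10 a20.
  have b0 : beta (x - s) (x + s) m.+1 ^+ 2 != 0.
    by rewrite (beta_sqr m hp s0 x) mulf_neq0// lt0r_neq0// (hn_gt0 m hp s0 x).
  split.
    transitivity ((a1_real m w1 p gamma s x * b1_real m p s x ^+ 2 + a2_real m w1 w2 p gamma s x * b2_real m p s x ^+ 2) /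
     (2 * (a1_real m w1 p gamma s x * b1_real m p s x + a2_real m w1 w2 p gamma s x * b2_real m p s x + m.+1%:R)))%:C.
      congr (real_complex R _); rewrite ab abb.
      by move: (beta _ _ _ ^+ 2) (alpha _ _ _) b0 => B A B0; field.
    move: (a1_real _ _ _ _ _ _) (a2_real _ _ _ _ _ _ _) (b1_real _ _ _ _) (b2_real _ _ _ _) => *.
    by real_complex_simpl.
  transitivity (2^-1 * (a1_real m w1 p gamma s x * b1_real m p s x + a2_real m w1 w2 p gamma s x * b2_real m p s x + m.+1%:R))%:C.
    by congr (real_complex R _); rewrite ab; move: (beta _ _ _ ^+ 2) => B; field.
  move: (a1_real _ _ _ _ _ _) (a2_real _ _ _ _ _ _ _) (b1_real _ _ _ _) (b2_real _ _ _ _) => *.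
  by real_complex_simpl.
- have k0 := @four_pi_i_neq0 R.
  have E : (0 +i* (4 * pi))^-1 * (expR (x ^+ 2))%:C * ((0 +i* (4 * pi)) * (gamma_sqr m gamma s x * expR (- x ^+ 2))%:C)
     = (gamma_sqr m gamma s x)%:C :> R[i].
    transitivity ((expR (x ^+ 2) * (gamma_sqr m gamma s x * expR (- x ^+ 2)))%:C).
      move: (gamma_sqr _ _ _ _) (expR _) (expR _) => g e e'; real_complex_simpl.
      by move: (0 +i* (4 * pi)) k0 => k k0; field.
    congr (real_complex R _); rewrite expRN.
    have := lt0r_neq0 (expR_gt0 (x ^+ 2)); move: (expR _) (gamma_sqr _ _ _ _) => e g ?; by field.
  rewrite E; split => //; first by rewrite real_neq0.
  apply: (is_derive_RC_real_eq _ (is_derive_ln_gamma m hp s0 x)) => //.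
  by move: (a1_real _ _ _ _ _ _) (a2_real _ _ _ _ _ _ _) => *; real_complex_simpl.
(* Common form of both identities: c is the height of the step, g = gamma_(n-1)^2, E the exponential
   prefactor, E' = e^(-s_k^2) and E'' = e^(-x^2), with s_k = x - s or x + s. The prefactor is
   exactly what makes E E' = E''. *)
- have H (c g E E' E'' v : R) : c != 0 -> g != 0 -> E'' != 0 -> E * E' = E'' ->
    (v ^+ 2)%:C = two_pi_i R / c%:C * E%:C
      * ((2 * g * (c * E') * v ^+ 2)%:C / ((0 +i* (4 * pi)) * (g * E'')%:C)).
    move=> c0 g0 E0 EE; have := kappa_neq0 (R := R); rewrite four_pi_iE.
    move: (two_pi_i R) => k k0; move: c0 g0 E0; rewrite -!real_neq0 -EE.
    rewrite !rmorphM !rmorph_nat /= mulf_eq0 negb_or => c0 g0 /andP[E0 E'0].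
    by field; rewrite k0 g0 E0 E'0 c0.
  have cast (a b : R) : a%:C * b%:C ^+ 2 = (a * b ^+ 2)%:C by real_complex_simpl.
  split=> [/A10 a10|/A20 a20]; rewrite cast.
    rewrite (abb1E a10); apply: (H _ _ _ (expR (- (x - s) ^+ 2)) _ (cur1_at m p s x)) => //; first by rewrite subr_eq0.
    by rewrite -expRD; congr expR; ring.
  rewrite (abb2E a20); apply: (H _ _ _ (expR (- (x + s) ^+ 2)) _ (cur2_at m p s x)) => //; first by rewrite subr_eq0 eq_sym.
  by rewrite -expRD; congr expR; ring.
Qed.
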